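(* Let $\mathcal{F}$ be a finite family of convex bodies in the plane which is noncrossing, in which no two members are tangent, and in which no three members share a common tangent line. Then $\mathcal{F}$ is in convex position if and only if there exists an ordering of $\mathcal{F}$ such that every triple $(A_i,A_j,A_k)$ with $i<j<k$ (in this ordering) is counterclockwise oriented.
   Context: A convex body is a compact convex set in the plane. A family $\mathcal{F}$ of sets is noncrossing if for every pair $A,B\in\mathcal{F}$ the sets $A\setminus B$ and $B\setminus A$ are connected. A family $\mathcal{F}$ is in convex position if for every $A\in\mathcal{F}$, $\mathrm{conv}(\bigcup\mathcal{F})\neq \mathrm{conv}(\bigcup(\mathcal{F}\setminus\{A\}))$. An ordered triple $(A_1,A_2,A_3)$ of noncrossing convex bodies is counterclockwise (resp. clockwise) oriented if there exist points $a_i\in A_i\cap \partial\,\mathrm{conv}(A_1\cup A_2\cup A_3)$, $i=1,2,3$, such that $a_1,a_2,a_3$ are oriented counterclockwise (resp. clockwise). (An ordered triple may have one, two, or no orientations.)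
   Formalization: For families with at most two members it is additionally assumed that no member is contained in the union of the others (a sole member is nonempty; of two, neither contains the other), since otherwise the ordering condition holds vacuously while convex position fails. *)

(* Defs.v *)
From HB Require Import structures.
From mathcomp Require Import all_boot all_order all_algebra.
From mathcomp Require Import all_classical all_reals all_analysis.

Set Implicit Arguments.
Unset Strict Implicit.
Unset Printing Implicit Defensive.

Import Order.TTheory GRing.Theory Num.Theory.
Import numFieldNormedType.Exports.

Local Open Scope classical_set_scope.
Local Open Scope ring_scope.

Notation plane R := 'rV[R]_2.

Definition convex_hull (R : realType) (A : set (plane R)) : set (plane R) :=
  smallest (@convex_set R (plane R)) A.

Definition boundary (T : topologicalType) (A : set T) : set T :=
  closure A `\` interior A.

Definition convex_body (R : realType) (A : set (plane R)) : Prop :=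
  compact A /\ convex_set A.

(* The empty set counts as connected, so nested pairs may be noncrossing. *)
Definition noncrossing (R : realType) (F : set (set (plane R))) : Prop :=
  forall A B, F A -> F B -> connected (A `\` B) /\ connected (B `\` A).

Definition in_convex_position (R : realType) (F : set (set (plane R))) : Prop :=
  forall A, F A ->
    convex_hull (\bigcup_(B in F) B) <> convex_hull (\bigcup_(B in F `\ A) B).

Definition dot (R : realType) (u x : plane R) : R := \sum_(i < 2) u 0 i * x 0 i.

Definition line (R : realType) (u : plane R) (c : R) : set (plane R) :=
  [set x | dot u x = c].

(* A tangent line is a supporting line; the body may lie on either side. *)
Definition tangent_line (R : realType) (l A : set (plane R)) : Prop :=
  exists (u : plane R) (c : R),
    [/\ u != 0, l = line u c, l `&` A !=set0 &
        (forall x, A x -> dot u x <= c) \/ (forall x, A x -> c <= dot u x)].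

(* Tangency at a common point, external as well as internal. *)
Definition tangent (R : realType) (A B : set (plane R)) : Prop :=
  exists l, [/\ tangent_line l A, tangent_line l B & l `&` (A `&` B) !=set0].

Definition ccw_points (R : realType) (a b c : plane R) : Prop :=
  0 < (b 0 0 - a 0 0) * (c 0 1 - a 0 1) - (b 0 1 - a 0 1) * (c 0 0 - a 0 0).

Definition ccw_oriented (R : realType) (A1 A2 A3 : set (plane R)) : Prop :=
  let K := convex_hull (A1 `|` A2 `|` A3) in
  exists a1 a2 a3 : plane R,
    [/\ (A1 `&` boundary K) a1, (A2 `&` boundary K) a2, (A3 `&` boundary K) a3 &
        ccw_points a1 a2 a3].

Definition ordering_of (T : eqType) (F : set T) (s : seq T) : Prop :=
  uniq s /\ [set` s] = F.

(* Main.v *)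
Require Import Defs.
From HB Require Import structures.
From mathcomp Require Import all_boot all_order all_algebra.
From mathcomp Require Import all_classical all_reals all_analysis.
From mathcomp Require Import ring lra zify.
Set Implicit Arguments.
Unset Strict Implicit.
Unset Printing Implicit Defensive.

Import Order.TTheory GRing.Theory Num.Theory.
Import numFieldNormedType.Exports.

Local Open Scope classical_set_scope.
Local Open Scope ring_scope.

(** For a direction [dir t = (cos t, sin t)] let [supp A t] be the support function
    of [A].  A family is in convex position iff every member is strictly on top of
    the upper envelope of the support functions in some direction.

    If the family is in convex position, choose for each member such a direction and
    a point extreme in it; sorting the members by direction, these points witness
    that all triples are counterclockwise.

    Conversely, for noncrossing [A] and [B] the sign of [supp A - supp B] cannot
    alternate four times around the circle: the chord of [B] joining two of its
    extreme points would cut [A `\` B].  The absence of tangencies makes all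
    crossings of support functions transversal, so a counterclockwise triple yields
    three directions in cyclic order in which its members are in turn strictly on
    top.  Fix a member [n] and consider the arcs [J k] where [supp k > supp n].
    Among the inclusion-maximal arcs take the one whose member [k] comes last in the
    cyclic order starting after [n].  If some [m] were above [n] at the right end of
    [J k], then [m] could be taken maximal, and the triple [(m, k, n)] would force
    four alternations between two of its members.  Hence [n] and [k] are on top
    there, and [n] is strictly on top nearby. *)

(** * Continuous functions on a circle *)

Section RealTools.
Variable R : realType.
Implicit Types (f g : R -> R) (P t w r : R).

Lemma shift_into_window P t w : 0 < P ->
  exists z : int, w <= t + P *~ z < w + P.
Proof.
move=> P0; exists (- Num.floor ((t - w) / P)).
have /andP[] := floor_itv ((t - w) / P); set n := Num.floor _.
rewrite ler_pdivlMr// ltr_pdivrMr// intrD -mulrzr mulrNz; lra.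
Qed.

Lemma periodicz (T : Type) P (f : R -> T) (z : int) t :
  (forall s, f (s + P) = f s) -> f (t + P *~ z) = f t.
Proof.
move=> fP; have nat (n : nat) s : f (s + P *+ n) = f s.
  by elim: n => [|n IH]; rewrite ?mulr0n ?addr0// mulrSr addrA fP.
case: z => n; first exact: nat.
rewrite NegzE -nmulrn -[LHS](nat n.+1); congr f.
by rewrite subrK.
Qed.

Lemma near_eps r (Q : R -> Prop) : (\forall t \near r, Q t) ->
  exists2 d, 0 < d & forall t, `|t - r| < d -> Q t.
Proof.
move=> /nbhs_ballP[d /= d0 dQ]; exists d => // t td; apply: dQ.
by rewrite /ball/= distrC.
Qed.

Lemma continuous_near_lt f g r : {for r, continuous f} ->
  {for r, continuous g} -> f r < g r ->
  \forall t \near r, f t < g t.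
Proof.
move=> cf cg fg.
have cgf : (fun t => g t - f t) t @[t --> r] --> g r - f r.
  by apply: cvgB; [exact: cg | exact: cf].
have gf0 : 0 < g r - f r by rewrite subr_gt0.
by near do rewrite -subr_gt0; exact: (cvgr_gt _ cgf).
Unshelve. all: by end_near.
Qed.

(** The crossing is the infimum of the points at or after [q] where [g <= f]. Continuity rules out a
    strict inequality either way there: one would push the infimum further right, the other would
    contradict [f < g] just to its left. *)
Lemma first_crossing f g q q' : continuous f -> continuous g ->
  q < q' -> f q < g q -> g q' <= f q' ->
  exists r, [/\ q < r, f r = g r & forall t, q <= t < r -> f t < g t].
Proof.
move=> cf cg qq fgq gfq'.
pose S := [set t | q <= t /\ g t <= f t].
have Sq' : S q' by split=> //; exact: ltW.
have Slb : lbound S q by move=> t [].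
have hiS : has_inf S by split; [exists q' | exists q].
have qr : q <= inf S by apply: lb_le_inf => //; exists q'.
have before t : q <= t < inf S -> f t < g t.
  move=> /andP[qt tr]; rewrite ltNge; apply/negP => gft.
  have : inf S <= t by apply: ge_inf; [exists q|].
  by rewrite leNgt tr.
have gfr : g (inf S) <= f (inf S).
  rewrite leNgt; apply/negP => fg.
  have [d d0 dP] := near_eps (continuous_near_lt (cf _) (cg _) fg).
  have [t [qt gft] tr] := inf_adherent d0 hiS.
  have rt : inf S <= t by apply: ge_inf; [exists q|].
  have : f t < g t by apply: dP; rewrite ger0_norm ?subr_ge0// ltrBlDl.
  by rewrite ltNge gft.
have qr' : q < inf S.
  rewrite lt_neqAle qr andbT; apply/eqP => qe.
  by move: gfr; rewrite -qe leNgt fgq.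
exists (inf S); split=> //; apply/eqP; rewrite eq_le gfr andbT leNgt.
apply/negP => gf.
have [d d0 dP] := near_eps (continuous_near_lt (cg _) (cf _) gf).
(* Clipping at [q] keeps [t] inside the range where [f < g] is known. *)
pose t := Num.max q (inf S - d / 2).
have : f t < g t.
  apply: before; rewrite le_max lexx/= gt_max qr'/=; lra.
have : g t < f t.
  apply: dP; rewrite distrC ger0_norm /t.
    case: (leP q (inf S - d / 2)); lra.
  case: (leP q (inf S - d / 2)); lra.
by move=> /lt_trans/[apply]; rewrite ltxx.
Qed.

End RealTools.

(** * Visibility in the upper envelope of finitely many periodic functions *)

Section Envelope.
Variables (R : realType) (P : R) (I : finType) (h : I -> R -> R) (n : I).
(** Linearizes the cyclic order of the members by cutting it at [n]: [key j < key k] means that [j],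
    [k], [n] occur in this cyclic order. *)
Variable key : I -> nat.

Hypothesis P_gt0 : 0 < P.
Hypothesis h_periodic : forall i t, h i (t + P) = h i t.
Hypothesis h_continuous : forall i, continuous (h i).
Hypothesis h_alternate : forall i j t1 t2 t3 t4, i != j ->
  t1 < t2 -> t2 < t3 -> t3 < t4 -> t4 < t1 + P ->
  h j t1 < h i t1 -> h i t2 < h j t2 -> h j t3 < h i t3 -> h i t4 < h j t4 ->
  False.
Hypothesis h_transversal : forall i j t d, i != j -> h i t = h j t -> 0 < d ->
  exists2 t', `|t' - t| < d & h i t' < h j t'.
Hypothesis h_no_triple : forall i j k t, i != j -> i != k -> j != k ->
  h i t = h j t -> h i t = h k t -> False.
Hypothesis key_inj : forall j k, j != n -> k != n -> j != k -> key j != key k.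
Hypothesis h_triple : forall j k, j != n -> k != n -> (key j < key k)%N ->
  exists tj tk tn, [/\ tj < tk, tk < tn & tn < tj + P] /\
    [/\ h k tj < h j tj, h n tj < h j tj,
        h j tk < h k tk, h n tk < h k tk &
        h j tn < h n tn /\ h k tn < h n tn].
Hypothesis card_I : (2 < #|I|)%N.

Local Lemma hz i (z : int) t : h i (t + P *~ z) = h i t.
Proof. by apply: (periodicz (f := h i)). Qed.

Local Lemma perturb_lt i j t d : i != j -> h i t <= h j t -> 0 < d ->
  exists2 t', `|t' - t| < d & h i t' < h j t'.
Proof.
move=> ij; rewrite le_eqVlt => /orP[/eqP|hij d0]; first exact: h_transversal.
by exists t => //; rewrite subrr normr0.
Qed.

(** Ties at [t2] and [t4] are tolerated because transversality breaks them in favour of [j]. Only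
    these two points move, each by less than its distance to its neighbours, so the cyclic order of
    the four points survives. *)
Local Lemma no_alternation i j t1 t2 t3 t4 : i != j ->
  t1 < t2 -> t2 < t3 -> t3 < t4 -> t4 < t1 + P ->
  h j t1 < h i t1 -> h i t2 <= h j t2 -> h j t3 < h i t3 -> h i t4 <= h j t4 ->
  False.
Proof.
move=> ij t12 t23 t34 t41 h1 h2 h3 h4.
pose d2 := Num.min (t2 - t1) (t3 - t2).
pose d4 := Num.min (t4 - t3) (t1 + P - t4).
have [|||t2' t2d h2'] := @perturb_lt i j t2 d2 => //.
  by rewrite lt_min; apply/andP; split; lra.
have [|||t4' t4d h4'] := @perturb_lt i j t4 d4 => //.
  by rewrite lt_min; apply/andP; split; lra.
move: t2d t4d; rewrite !lt_min !ltr_norml.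
move=> /andP[/andP[? ?] /andP[? ?]] /andP[/andP[? ?] /andP[? ?]].
by apply: (@h_alternate i j t1 t2' t3 t4') => //; lra.
Qed.

Let J j := [set t | h n t < h j t].

(** A third member [m] completes a triple with [k] and [n], in which both [k] and [n] are strictly
    on top somewhere. *)
Local Lemma J_inhabited k : k != n -> (exists q, J k q) /\ (exists t, h k t < h n t).
Proof.
move=> kn; have [m mn mk] : exists2 m, m != n & m != k.
  have : (0 < #|[set~ n] :\ k|)%N.
    have := cardsC1 n; have := cardsD1 k [set~ n]; rewrite !inE kn => -> ?; lia.
  by rewrite card_gt0 => /set0Pn[m]; rewrite !inE => /andP[? ?]; exists m.
have := key_inj mn kn mk; rewrite neq_ltn => /orP[] lt.
  have [_ [tk [tn [_ [_ _ _ ? [_ ?]]]]]] := h_triple mn kn lt.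
  by split; [exists tk | exists tn].
have [tk [_ [tn [_ [_ ? _ _ [? _]]]]]] := h_triple kn mn lt.
by split; [exists tk | exists tn].
Qed.

Local Lemma right_end k : k != n ->
  exists q r, [/\ q < r, h n r = h k r & forall t, q <= t < r -> h n t < h k t].
Proof.
move=> kn; have [[q Jq] [t ht]] := J_inhabited kn.
have [z /andP[qt _]] := shift_into_window t q P_gt0.
have Jt : h k (t + P *~ z) <= h n (t + P *~ z) by rewrite !hz ltW.
have qt' : q < t + P *~ z.
  rewrite lt_neqAle qt andbT; apply/eqP => qe.
  by move: Jt; rewrite -qe leNgt Jq.
have [r [? ? ?]] := first_crossing (@h_continuous n) (@h_continuous k) qt' Jq Jt.
by exists q, r.
Qed.

(** A point [p] of [J k] outside [J m] is placed relative to the three directions of the triple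
    [(m, k, n)] and to [r]. Every possible placement makes two of the three functions alternate four
    times within one period. *)
Local Lemma crossing_arcs m k q r : m != n -> k != n -> m != k ->
  (key m < key k)%N -> q < r -> h n r = h k r ->
  (forall t, q <= t < r -> h n t < h k t) ->
  h n r < h m r -> J k `<=` J m.
Proof.
move=> mn kn mk mk_key qr hr hq hmr p Jp; apply: contrapT => nJp.
have {nJp} hp : h m p <= h n p by rewrite leNgt; apply/negP.
have [tm [tk [tn [[tmk tkn tnm] [km nm mk' nk [mtn ktn]]]]]] := h_triple mn kn mk_key.
(* The circle is cut open at [r]: [p] and [tn] are moved into the period ending at [r], and [tm],
   [tk] are translated together with [tn]. *)
have [zp /andP[rp pr]] := shift_into_window p (r - P) P_gt0.
have [z /andP[rn nr]] := shift_into_window tn (r - P) P_gt0.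
move: Jp hp km nm mk' nk mtn ktn; rewrite /J/=.
rewrite -(hz n zp p) -(hz k zp p) -(hz m zp p).
rewrite -(hz n z tm) -(hz k z tm) -(hz m z tm).
rewrite -(hz n z tn) -(hz k z tn) -(hz m z tn).
rewrite -(hz n z tk) -(hz k z tk) -(hz m z tk).
have {}tmk : tm + P *~ z < tk + P *~ z by rewrite ltrD2r.
have {}tkn : tk + P *~ z < tn + P *~ z by rewrite ltrD2r.
have {}tnm : tn + P *~ z < tm + P *~ z + P by rewrite addrAC ltrD2r.
move: rp pr rn nr tmk tkn tnm; set p' := p + _; set um := tm + _.
set uk := tk + _; set un := tn + _; clearbody p' um uk un.
rewrite !subrK.
move=> rp pr rn nr tmk tkn tnm hp1 hp2 km nm mk' nk mtn ktn.
have hP i : h i (r - P) = h i r by rewrite -(h_periodic i (r - P)) subrK.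
have rp' : r - P < p'.
  rewrite lt_neqAle rp andbT; apply/eqP => e.
  by move: hp1; rewrite -e !hP hr ltxx.
have rn' : r - P < un.
  rewrite lt_neqAle rn andbT; apply/eqP => e.
  by move: ktn; rewrite -e !hP hr ltxx.
have nq : un < q.
  by rewrite ltNge; apply/negP => qn; have := hq un; rewrite qn nr => /(_ isT); lra.
(* Otherwise [k] and [n] alternate at [p'], [un], [q], [r]. *)
have np : un < p'.
  rewrite ltNge le_eqVlt; apply/negP => /orP[/eqP e|pn]; first by move: ktn; rewrite -e; lra.
  apply: (@no_alternation k n p' un q r) => //; rewrite ?hr//; try lra.
  by apply: hq; rewrite lexx qr.
(* If [uk] also lies in this period, [k] and [n] alternate at [uk], [un], [q], [r]. If not, one
   further period brings [um] and [uk] between [un] and [r]. *)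
have [uk1|uk1] := leP (r - P) uk.
  have rk' : r - P < uk.
    rewrite lt_neqAle uk1 andbT; apply/eqP => e.
    by move: nk; rewrite -e !hP hr ltxx.
  apply: (@no_alternation k n uk un q r) => //; rewrite ?hr//; try lra.
  by apply: hq; rewrite lexx qr.
move: km nm mk' nk.
rewrite -(h_periodic n um) -(h_periodic k um) -(h_periodic m um).
rewrite -(h_periodic n uk) -(h_periodic k uk) -(h_periodic m uk).
move=> km nm mk' nk.
(* Before [um + P], the pair [k], [m] alternates, since [h m <= h n < h k] at [p'] and
   [h k = h n < h m] at [r]. After it, [m] and [n] alternate. At it, [m] would be both above and not
   above [n]. *)
have [pm|mp|pm] := ltgtP p' (um + P).
- by apply: (@no_alternation k m p' (um + P) (uk + P) r); rewrite 1?eq_sym//; lra.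
- apply: (@no_alternation m n (um + P) p' r (un + P)) => //; try lra.
  by rewrite !h_periodic; lra.
- by move: nm; rewrite -pm; lra.
Qed.

Lemma envelope_visible : exists t, forall m, m != n -> h m t < h n t.
Proof.
(* Counts the arcs containing [J m]. A member minimizing [c] among those whose arc contains a given
   one has an inclusion-maximal arc. *)
pose c m := #|[pred x | (x != n) && `[< J m `<=` J x >]]|.
pose maxl k := [forall x, ((x != n) && `[< J k `<=` J x >]) ==> `[< J x `<=` J k >]].
have maxl_ex m : m != n -> exists k, [/\ k != n, maxl k & J m `<=` J k].
  move=> mn; have m0 : (m != n) && `[< J m `<=` J m >].
    by rewrite mn; apply/asboolP.
  case: (@arg_minnP I m (fun x => (x != n) && `[< J m `<=` J x >]) c m0)
    => k /andP[kn /asboolP mk] kmin.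
  exists k; split=> //; apply/forallP => x; apply/implyP => /andP[xn /asboolP kx].
  apply/asboolP; apply: contrapT => xk.
  have : (c k <= c x)%N.
    by apply: kmin; rewrite xn; apply/asboolP; exact: subset_trans kx.
  apply/negP; rewrite -ltnNge /c; apply: proper_card; apply/properP; split.
    apply/fintype.subsetP => y; rewrite !inE => /andP[-> /asboolP xy]; apply/asboolP.
    exact: subset_trans xy.
  exists k; rewrite !inE kn; last by apply/asboolP.
  by apply/asboolP.
have [m mn] : exists m, m != n.
  have : (0 < #|[set~ n]%SET|)%N by have := cardsC1 n; move=> ->; lia.
  by rewrite card_gt0 => /set0Pn[m]; rewrite !inE => ?; exists m.
have [k0 [k0n k0m _]] := maxl_ex _ mn.
have k0P : (k0 != n) && maxl k0 by rewrite k0n.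
case: (@arg_maxnP I k0 (fun x => (x != n) && maxl x) key k0P) => k /andP[kn km] kmax.
have [q [r [qr hr hq]]] := right_end kn.
have below m' : m' != n -> m' != k -> h m' r < h n r.
  move=> m'n m'k; rewrite ltNge; apply/negP; rewrite le_eqVlt => /orP[/eqP e|lt].
    by apply: (@h_no_triple n m' k r); rewrite // eq_sym.
  have [x [xn xm m'x]] := maxl_ex _ m'n.
  have rx : J x r by exact: m'x.
  have xk : x != k by apply/eqP => e; move: rx; rewrite e /J/= hr ltxx.
  have : (key x <= key k)%N by apply: kmax; rewrite xn.
  rewrite leq_eqVlt (negbTE (key_inj xn kn xk))/= => xk_key.
  (* Maximality of [J k] turns this inclusion around, which puts [r] in [J k] although [n] and [k]
     agree at [r]. *)
  have kx := crossing_arcs xn kn xk xk_key qr hr hq rx.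
  move/forallP/(_ x)/implyP: km; rewrite xn => /(_ (asboolT kx))/asboolP/(_ _ rx).
  by rewrite /J/= hr ltxx.
(* Finiteness keeps all members other than [k] below [n] on one neighbourhood of [r]; transversality
   then provides a point of it where [n] beats [k] as well. *)
have : \forall t \near r, forall m', (m' != n) && (m' != k) -> h m' t < h n t.
  apply: (@filter_forall R I
    (fun m' t => (m' != n) && (m' != k) -> h m' t < h n t)
    (nbhs r) (nbhs_filter r)) => m'.
  case: (boolP (_ && _)) => [/andP[? ?]|_].
    near=> t => _; near: t.
    by apply: continuous_near_lt; [exact: h_continuous|exact: h_continuous|exact: below].
  by near=> t.
move=> /near_eps[d d0 dP].
have [t td ht] := h_transversal kn (esym hr) d0.
exists t => m' m'n; have [->//|m'k] := eqVneq m' k.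
by apply: dP => //; rewrite m'n.
Unshelve. all: by end_near.
Qed.

End Envelope.

(** * Convex hulls and separation in the plane *)

Section Plane.
Variable R : realType.
Implicit Types (u x y z a b : plane R) (A B K : set (plane R)) (t c l : R).

Lemma planeP x y : x 0 0 = y 0 0 -> x 0 1 = y 0 1 -> x = y.
Proof.
move=> e0 e1; apply/rowP => i; case: i => -[|[|//]] ip.
  by rewrite (_ : Ordinal ip = 0)//; exact: val_inj.
by rewrite (_ : Ordinal ip = 1)//; exact: val_inj.
Qed.

Lemma dotE u x : dot u x = u 0 0 * x 0 0 + u 0 1 * x 0 1.
Proof.
rewrite /dot !big_ord_recl big_ord0 addr0.
by rewrite (_ : lift ord0 ord0 = 1)//; exact: val_inj.
Qed.

Lemma dotBr u x y : dot u (x - y) = dot u x - dot u y.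
Proof. by rewrite !dotE !mxE; ring. Qed.

Lemma dotDr u x y : dot u (x + y) = dot u x + dot u y.
Proof. by rewrite !dotE !mxE; ring. Qed.

Lemma dotZr u c x : dot u (c *: x) = c * dot u x.
Proof. by rewrite !dotE !mxE; ring. Qed.

Lemma dotZl u c x : dot (c *: u) x = c * dot u x.
Proof. by rewrite !dotE !mxE; ring. Qed.

Definition dotr := (dotBr, dotDr, dotZr).

Lemma coord_cvg (p : plane R) i : (fun x : plane R => x 0 i) x @[x --> p] --> p 0 i.
Proof. exact: (@coord_continuous R 1 2 0 i p). Qed.

Lemma dot_continuous u : continuous (dot u).
Proof.
move=> x; rewrite (_ : dot u = fun x => u 0 0 * x 0 0 + u 0 1 * x 0 1); last first.
  by apply/funext => y; exact: dotE.
rewrite /continuous_at.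
exact: (cvgD (cvgM (cvg_cst (u 0 0)) (@coord_cvg x 0))
             (cvgM (cvg_cst (u 0 1)) (@coord_cvg x 1))).
Qed.

Lemma convex_comb A x y l : convex_set A -> A x -> A y -> 0 <= l <= 1 ->
  A (l *: x + (1 - l) *: y).
Proof.
move=> cA Ax Ay /andP[l0 l1].
have := cA x y (Itv01 l0 l1); rewrite !inE => /(_ Ax Ay).
by rewrite /conv/=.
Qed.

Lemma convex_setI A :
  (forall x y l, A x -> A y -> 0 <= l <= 1 -> A (l *: x + (1 - l) *: y)) ->
  convex_set A.
Proof.
move=> cA x y l; rewrite !inE => Ax Ay; apply: cA => //.
by apply/andP; split; [exact: ge0 | exact: le1].
Qed.

(** Normalizing the weights gives a convex combination. When both weights vanish, any point of [A]
    serves as [z]. *)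
Lemma convex_cone A x y (c d : R) : convex_set A -> A x -> A y ->
  0 <= c -> 0 <= d -> exists2 z, A z & c *: x + d *: y = (c + d) *: z.
Proof.
move=> cA Ax Ay c0 d0; have [cd|cd] := eqVneq (c + d) 0.
  have [-> ->] : c = 0 /\ d = 0 by split; lra.
  by exists x; rewrite // addr0 !scale0r addr0.
exists (c / (c + d) *: x + (1 - c / (c + d)) *: y).
  apply: convex_comb => //; rewrite divr_ge0 ?addr_ge0//=.
  by rewrite ler_pdivrMr ?mul1r ?lerDl// lt_neqAle eq_sym cd addr_ge0.
by apply: planeP; rewrite !mxE; field.
Qed.

Lemma convex_hull_convex A : convex_set (convex_hull A).
Proof.
apply: convex_setI => x y l hx hy l01 B [cB AB].
by apply: convex_comb => //; [exact: hx | exact: hy].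
Qed.

Lemma sub_convex_hull A : A `<=` convex_hull A.
Proof. exact: sub_gen_smallest. Qed.

Lemma convex_hull_min A K : convex_set K -> A `<=` K -> convex_hull A `<=` K.
Proof. exact: smallest_sub. Qed.

Lemma convex_hull_mono A B : A `<=` B -> convex_hull A `<=` convex_hull B.
Proof.
move=> AB; apply: convex_hull_min; first exact: convex_hull_convex.
exact: subset_trans AB (@sub_convex_hull _).
Qed.

Lemma convex_halfplane_le u c : convex_set [set x : plane R | dot u x <= c].
Proof. by apply: convex_setI => x y l /= hx hy /andP[? ?]; rewrite !dotr; nra. Qed.

Lemma convex_halfplane_lt u c : convex_set [set x : plane R | dot u x < c].
Proof.
apply: convex_setI => x y l /= hx hy /andP[l0 l1]; rewrite !dotr.
by have [l2|l2] := leP l (1 / 2); nra.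
Qed.

(** For convex sets the hull of the union consists of the segments from [A] to [B], hence is the
    continuous image of a compact product. *)
Lemma convex_body_join A B : convex_body A -> convex_body B ->
  A !=set0 -> B !=set0 -> compact (convex_hull (A `|` B)).
Proof.
move=> [kA cA] [kB cB] [a0 Aa0] [b0 Bb0].
pose f (p : plane R * plane R * R) := p.2 *: p.1.1 + (1 - p.2) *: p.1.2.
have -> : convex_hull (A `|` B) = f @` (A `*` B `*` `[0, 1]%classic).
  apply/seteqP; split.
    apply: convex_hull_min.
      apply: convex_setI => x y m [[[a b] l] /= [[Aa Bb] lI] <-].
      move=> [[[a' b'] l'] /= [[Aa' Bb'] lI'] <-] /andP[m0 m1].
      move: lI lI'; rewrite !in_itv/= => /andP[l0 l1] /andP[l0' l1'].
      (* In a combination of two points of the join, the parts from [A] merge into one point of [A],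
         and likewise for [B]. *)
      have [|||||a2 Aa2 ea] := @convex_cone A a a' (m * l) ((1 - m) * l') => //.
      - by nra.
      - by nra.
      have [|||||b2 Bb2 eb] := @convex_cone B b b' (m * (1 - l)) ((1 - m) * (1 - l')) => //.
      - by nra.
      - by nra.
      exists ((a2, b2), m * l + (1 - m) * l').
        by split=> //; rewrite /= in_itv/=; apply/andP; split; nra.
      rewrite /f/= -ea.
      rewrite (_ : 1 - (m * l + (1 - m) * l') = m * (1 - l) + (1 - m) * (1 - l')); last by ring.
      by rewrite -eb; apply: planeP; rewrite !mxE; ring.
    move=> x [Ax|Bx].
      exists ((x, b0), 1); first by split=> //=; rewrite in_itv/= lexx ler01.
      by rewrite /f/= subrr scale0r addr0 scale1r.
    exists ((a0, x), 0); first by split=> //=; rewrite in_itv/= lexx ler01.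
    by rewrite /f/= subr0 scale0r add0r scale1r.
  move=> x [[[a b] l] /= [[Aa Bb]]]; rewrite in_itv/= => l01 <-.
  apply: convex_comb => //; first exact: convex_hull_convex.
    by apply: sub_convex_hull; left.
  by apply: sub_convex_hull; right.
apply: continuous_compact; last first.
  by apply: compact_setX; [exact: compact_setX | exact: segment_compact].
apply: continuous_subspaceT => p; apply: cvgD; apply: cvgZ.
- exact: cvg_snd.
- by apply: cvg_comp; [exact: cvg_fst | exact: cvg_fst].
- by apply: cvgB; [exact: cvg_cst | exact: cvg_snd].
- by apply: cvg_comp; [exact: cvg_fst | exact: cvg_snd].
Qed.

Lemma convex_hull_finite_compact (s : seq (set (plane R))) :
  (forall A, A \in s -> convex_body A) ->
  compact (convex_hull (\bigcup_(A in [set` s]) A)).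
Proof.
elim: s => [|A s IH] sb.
  rewrite set_nil bigcup_set0 /convex_hull smallest_id; first exact: compact0.
  by apply: convex_setI.
have bA : convex_body A by apply: sb; rewrite mem_head.
have /IH cU : forall B, B \in s -> convex_body B.
  by move=> B Bs; apply: sb; rewrite inE Bs orbT.
rewrite (_ : [set` A :: s] = A |` [set` s]); last first.
  by apply/seteqP; split=> B /=; rewrite inE => /predU1P.
rewrite bigcup_setU1; set U := \bigcup_(_ in _) _ in cU *.
have [A0|/set0P A0] := eqVneq A set0; first by rewrite A0 set0U.
have [U0|/set0P U0] := eqVneq U set0.
  by rewrite U0 setU0 /convex_hull smallest_id; case: bA.
(* Replacing [U] by its hull does not change the outer hull and reduces the claim to the join of two
   convex bodies. *)
rewrite (_ : convex_hull _ = convex_hull (A `|` convex_hull U)).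
  apply: convex_body_join => //; first by split=> //; exact: convex_hull_convex.
  by case: U0 => x Ux; exists x; exact: sub_convex_hull.
apply/seteqP; split.
  by apply: convex_hull_mono; apply: setUS; exact: sub_convex_hull.
apply: convex_hull_min; first exact: convex_hull_convex.
rewrite subUset; split.
  exact: subset_trans (@subsetUl _ _ _) (@sub_convex_hull _).
exact: convex_hull_mono (@subsetUr _ _ _).
Qed.

(** * Unit directions, polar form and strict separation *)

Definition dir t : plane R := \row_(j < 2) (if j == 0 then cos t else sin t).

Lemma dir0 t : dir t 0 0 = cos t. Proof. by rewrite mxE. Qed.
Lemma dir1 t : dir t 0 1 = sin t. Proof. by rewrite mxE. Qed.

Lemma dot_dir t x : dot (dir t) x = cos t * x 0 0 + sin t * x 0 1.
Proof. by rewrite dotE dir0 dir1. Qed.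

Lemma dir_periodic t : dir (t + pi *+ 2) = dir t.
Proof. by apply: planeP; rewrite ?dir0 ?dir1 ?cosD2pi ?sinD2pi. Qed.

Lemma dirDpi t : dir (t + pi) = - dir t.
Proof. by apply: planeP; rewrite [RHS]mxE ?dir0 ?dir1 ?cosDpi ?sinDpi. Qed.

Lemma dir_neq0 t : dir t != 0.
Proof.
apply/eqP => e; have := cos2Dsin2 t; rewrite -dir0 -dir1 e !mxE; lra.
Qed.

Lemma polar x : x != 0 -> exists2 t, 0 < Num.sqrt (dot x x) & x = Num.sqrt (dot x x) *: dir t.
Proof.
move=> x0.
have n0 : 0 < dot x x.
  rewrite dotE lt_neqAle; apply/andP; split; last by nra.
  rewrite eq_sym; apply: contra_neq x0 => e.
  by apply: planeP; rewrite mxE; nra.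
have m0 : 0 < Num.sqrt (dot x x) by rewrite sqrtr_gt0.
have m2 : Num.sqrt (dot x x) ^+ 2 = x 0 0 ^+ 2 + x 0 1 ^+ 2.
  by rewrite sqr_sqrtr ?ltW// dotE !expr2.
set m := Num.sqrt _ in m0 m2 *.
pose a := x 0 0 / m; pose b := x 0 1 / m.
have ab : a ^+ 2 + b ^+ 2 = 1 by rewrite /a /b !expr_div_n -mulrDl -m2 divff// expf_neq0// gt_eqF.
have aI : -1 <= a <= 1 by apply/andP; split; nra.
have sa : sin (acos a) = `|b|.
  by rewrite sin_acos// (_ : 1 - a ^+ 2 = b ^+ 2) ?sqrtr_sqr//; lra.
have ca : cos (acos a) = a by rewrite acosK// in_itv.
have mN : m != 0 by rewrite gt_eqF.
(* [acos] determines the angle only up to sign; the sign of the second coordinate decides. *)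
have [b0|b0] := leP 0 b.
  exists (acos a) => //; apply: planeP; rewrite mxE ?dir0 ?dir1 ?ca ?sa
    ?ger0_norm// /a /b; by field.
exists (- acos a) => //; apply: planeP; rewrite mxE ?dir0 ?dir1 ?cosN ?sinN ?ca ?sa
  ?ltr0_norm// /a /b; by field.
Qed.

(** The separating direction points from the nearest point [p] of [K] to [x]: a point [z] of [K]
    making an acute angle with it at [p] would allow a move from [p] towards [z] and closer to
    [x]. *)
Lemma separation K x : compact K -> convex_set K -> ~ K x ->
  exists t, forall y, K y -> dot (dir t) y < dot (dir t) x.
Proof.
move=> kK cK nKx; have [K0|/set0P K0] := eqVneq K set0.
  by exists 0 => y; rewrite K0.
(* The squared Euclidean distance is written out, since the norm of the plane here is the maximum
   norm. *)
pose f y := (y 0 0 - x 0 0) ^+ 2 + (y 0 1 - x 0 1) ^+ 2.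
have cf : {within K, continuous f}.
  apply: continuous_subspaceT => p.
  have cB i : (fun y : plane R => y 0 i - x 0 i) y @[y --> p] --> p 0 i - x 0 i.
    exact: (cvgB (@coord_cvg p i) (cvg_cst (x 0 i))).
  rewrite /continuous_at.
  exact: (cvgD (cvgM (cB 0) (cB 0)) (cvgM (cB 1) (cB 1))).
have [p] := compact_EVT_min K0 kK cf; rewrite inE => Kp pmin.
have [|t c0 e] := @polar (x - p).
  by rewrite subr_eq0; apply/eqP => e; apply: nKx; rewrite e.
exists t => z Kz; rewrite -subr_gt0 -dotBr -(pmulr_rgt0 _ c0) -dotZl -e.
have -> : x - z = (x - p) - (z - p) by rewrite opprB addrA subrK.
rewrite dotBr.
have u0 : 0 < dot (x - p) (x - p) by rewrite -sqrtr_gt0.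
suff : dot (x - p) (z - p) <= 0 by lra.
rewrite leNgt; apply/negP => D0.
have W0 : 0 <= dot (z - p) (z - p) by rewrite dotE; nra.
set D := dot _ _ in D0; set W := dot _ _ in W0.
have DW : 0 < D + W by lra.
(* This step length lies in [(0, 1]] and satisfies [l * W < D], so the decrease [2 * l * D]
   outweighs [l ^+ 2 * W]. *)
pose l := D / (D + W).
have lE : l * (D + W) = D by rewrite /l divfK// gt_eqF.
have l0 : 0 < l by rewrite divr_gt0.
have l1 : l <= 1 by rewrite ler_pdivrMr//; lra.
have := pmin (l *: z + (1 - l) *: p); rewrite inE => /(_ _).
have : K (l *: z + (1 - l) *: p) by apply: convex_comb => //; rewrite ltW.
move=> /[swap] /[apply].
have -> : f (l *: z + (1 - l) *: p) = f p - 2 * l * D + l ^+ 2 * W.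
  by rewrite /f /D /W !dotE !mxE; ring.
move=> ?; have : 2 * D <= l * W by rewrite -(ler_pM2l l0); nra.
nra.
Qed.

End Plane.

(** * Support functions *)

Section Support.
Variable R : realType.
Implicit Types (u x y z a b : plane R) (A B K : set (plane R)) (t s c l : R).

Lemma dotNl u x : dot (- u) x = - dot u x.
Proof. by rewrite !dotE !mxE; ring. Qed.

Lemma dot_dirD t s x :
  dot (dir (t + s)) x = cos s * dot (dir t) x + sin s * dot (dir (t + pi / 2)) x.
Proof. by rewrite !dot_dir cosDpihalf sinDpihalf cosD sinD; ring. Qed.

Lemma dot_dir_rot t s c : dot (dir t) (c *: dir (s + pi / 2)) = c * sin (t - s).
Proof. by rewrite dotZr dot_dir dir0 dir1 cosDpihalf sinDpihalf sinB; ring. Qed.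

Lemma dir_frame t x :
  x = dot (dir t) x *: dir t + dot (dir (t + pi / 2)) x *: dir (t + pi / 2).
Proof.
have e := cos2Dsin2 t.
apply: planeP; rewrite !mxE !dot_dir ?dir0 ?dir1 cosDpihalf sinDpihalf /=;
  set p := cos t in e *; set q := sin t in e *.
- by transitivity ((p ^+ 2 + q ^+ 2) * x 0 0); [rewrite e mul1r | ring].
- by transitivity ((p ^+ 2 + q ^+ 2) * x 0 1); [rewrite e mul1r | ring].
Qed.

(** [dir t] is the right-hand normal of [x], so [dot (dir t)] is constant along any chord in
    direction [x]. The window is closed on the right, which is why the angle is shifted with its
    sign reversed. *)
Lemma polar_window x (w : R) : x != 0 -> exists t c,
  [/\ 0 < c, w - pi *+ 2 < t <= w & x = c *: dir (t + pi / 2)].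
Proof.
move=> /polar[s c0 e]; set c := Num.sqrt _ in c0 e.
have P0 : 0 < pi *+ 2 :> R by rewrite mulrn_wgt0// pi_gt0.
have [z /andP[z1 z2]] := shift_into_window (- (s - pi / 2)) (- w) P0.
exists (s - pi / 2 - (pi *+ 2) *~ z), c; split=> //.
  by apply/andP; split; lra.
rewrite {1}e; congr (_ *: _); rewrite addrAC subrK -mulrNz.
by rewrite (periodicz (f := @dir R))// => t; exact: dir_periodic.
Qed.

Lemma sin_lt0_pi (x : R) : pi < x < pi *+ 2 -> sin x < 0.
Proof.
move=> /andP[x1 x2]; rewrite -[x](subrK pi) sinDpi oppr_lt0.
by apply: sin_gt0_pi; apply/andP; split; lra.
Qed.

Lemma coord_le_norm x i : `|x 0 i| <= `|x|.
Proof.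
rewrite [leRHS]/Num.Def.normr /= mx_normrE; apply/bigmax_geP; right => /=.
by exists (0, i).
Qed.

Lemma compact_coord_bound A : compact A ->
  exists2 M : R, 0 < M & forall x i, A x -> `|x 0 i| <= M.
Proof.
move=> /compact_bounded[M [Mr AM]]; exists (`|M| + 1); first by rewrite ltr_pwDr.
move=> x i Ax; apply: le_trans (coord_le_norm x i) _; apply: AM => //.
by rewrite (le_lt_trans (ler_norm M))// ltrDl.
Qed.

(** With coordinates bounded by [M] on [A], changes of cosine and sine below [n / (2 * M)]
    contribute less than [n / 2] each, uniformly in the point. *)
Lemma dot_dir_equicontinuous A t (n : R) : compact A -> 0 < n ->
  exists2 d, 0 < d & forall s, `|s - t| < d -> forall x, A x ->
    `|dot (dir s) x - dot (dir t) x| < n.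
Proof.
move=> /compact_coord_bound[M M0 AM] n0.
have e0 : 0 < n / (2 * M) by rewrite divr_gt0// mulr_gt0.
have : \forall s \near t, `|cos t - cos s| < n / (2 * M) /\ `|sin t - sin s| < n / (2 * M).
  apply: filterI.
    by move/cvgrPdist_lt : (@continuous_cos R t); apply.
  by move/cvgrPdist_lt : (@continuous_sin R t); apply.
move=> /near_eps[d d0 dP]; exists d => // s /dP[c1 s1] x Ax.
rewrite !dot_dir.
have -> : cos s * x 0 0 + sin s * x 0 1 - (cos t * x 0 0 + sin t * x 0 1) =
  - ((cos t - cos s) * x 0 0 + (sin t - sin s) * x 0 1) by ring.
rewrite normrN; apply: le_lt_trans (ler_normD _ _) _; rewrite !normrM.
have -> : n = n / (2 * M) * M + n / (2 * M) * M by field; rewrite gt_eqF.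
apply: ltrD.
  apply: (@le_lt_trans _ _ (`|cos t - cos s| * M)); last by rewrite ltr_pM2r.
  by apply: ler_wpM2l => //; exact: AM.
apply: (@le_lt_trans _ _ (`|sin t - sin s| * M)); last by rewrite ltr_pM2r.
by apply: ler_wpM2l => //; exact: AM.
Qed.

Definition supp A t := sup [set dot (dir t) x | x in A].

Lemma dot_max A u : compact A -> A !=set0 ->
  exists2 x, A x & forall y, A y -> dot u y <= dot u x.
Proof.
move=> kA A0; have cd : {within A, continuous (dot u)}.
  by apply: continuous_subspaceT; exact: dot_continuous.
have [x] := compact_EVT_max A0 kA cd; rewrite inE => Ax xm; exists x => // y Ay.
by apply: xm; rewrite inE.
Qed.

Lemma le_supp A t x : compact A -> A x -> dot (dir t) x <= supp A t.
Proof.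
move=> kA Ax; have [|y Ay ym] := @dot_max A (dir t) kA; first by exists x.
apply: ub_le_sup; last by exists x.
by exists (dot (dir t) y) => _ [z Az <-]; exact: ym.
Qed.

Lemma supp_attained A t : compact A -> A !=set0 ->
  exists2 x, A x & dot (dir t) x = supp A t.
Proof.
move=> kA A0; have [x Ax xm] := @dot_max A (dir t) kA A0.
exists x => //; apply/eqP; rewrite eq_le le_supp//= ge_sup//.
  by exists (dot (dir t) x); exists x.
by move=> _ [z Az <-]; exact: xm.
Qed.

Lemma supp_lt A t c : compact A -> A !=set0 ->
  (forall x, A x -> dot (dir t) x < c) -> supp A t < c.
Proof. by move=> kA A0 Ac; have [x Ax <-] := supp_attained t kA A0; exact: Ac. Qed.

Lemma supp_periodic A t : supp A (t + pi *+ 2) = supp A t.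
Proof. by rewrite /supp dir_periodic. Qed.

Lemma supp_continuous A : compact A -> A !=set0 -> continuous (supp A).
Proof.
move=> kA A0 t; apply/cvgrPdist_lt => n n0.
have [d d0 dP] := dot_dir_equicontinuous t kA n0.
apply/nbhs_ballP; exists d => // s; rewrite /ball/= distrC => /dP {}dP.
have [x Ax ex] := supp_attained t kA A0.
have [y Ay ey] := supp_attained s kA A0.
have := dP _ Ax; have := dP _ Ay.
have := le_supp s kA Ax; have := le_supp t kA Ay.
by rewrite !ltr_norml ex ey => ? ? /andP[? ?] /andP[? ?]; apply/andP; split; lra.
Qed.

Lemma supp1 a t : supp [set a] t = dot (dir t) a.
Proof.
have [|x -> //] := @supp_attained [set a] t (@compact_set1 _ a).
by exists a.
Qed.

(** Without a supporting direction, the gap [supp K t - dot (dir t) a] is positive for all [t],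
    hence by periodicity bounded below by a positive minimum. A point outside [K] too close to [a]
    could then not be separated from [K]. *)
Lemma supporting_direction K a : compact K -> convex_set K -> K a ->
  ~ interior K a ->
  exists t, forall y, K y -> dot (dir t) y <= dot (dir t) a.
Proof.
move=> kK cK Ka nint; apply: contrapT => nt.
have K0 : K !=set0 by exists a.
have lt t : dot (dir t) a < supp K t.
  rewrite ltNge; apply/negP => le; apply: nt; exists t => y Ky.
  exact: le_trans (le_supp t kK Ky) le.
pose g t := supp K t - supp [set a] t.
have cg : continuous g.
  move=> t; apply: cvgB; apply: supp_continuous => //; first exact: compact_set1.
  by exists a.
have P0 : 0 < pi *+ 2 :> R by rewrite mulrn_wgt0// pi_gt0.
have [t0 _ tmin] := EVT_min (ltW P0) (continuous_subspaceT cg).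
have e0 : 0 < g t0 by rewrite /g subr_gt0 supp1.
have emin t : g t0 <= g t.
  have [z /andP[z1 z2]] := shift_into_window t 0 P0.
  rewrite -(periodicz (f := g) (P := pi *+ 2) z t); last first.
    by move=> s; rewrite /g !supp_periodic.
  by apply: tmin; rewrite in_itv/= z1 ltW// -[ltRHS]add0r z2.
(* In the maximum norm each of the two coordinates may change [dot (dir t)] by less than the radius,
   so half the minimal gap suffices. *)
apply: nint; apply/nbhs_ballP; exists (g t0 / 2); first by rewrite /= divr_gt0.
move=> y; rewrite -ball_normE /= => ay; apply: contrapT => nKy.
have [t tsep] := separation kK cK nKy.
have : supp K t < dot (dir t) y by apply: supp_lt.
have := emin t; rewrite [X in _ <= X]/g supp1.
have := le_lt_trans (coord_le_norm (a - y) 0) ay.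
have := le_lt_trans (coord_le_norm (a - y) 1) ay.
rewrite !mxE !dot_dir !ltr_norml => /andP[? ?] /andP[? ?].
have := cos_max t; have := sin_max t.
rewrite !ler_norml => /andP[? ?] /andP[? ?] ? ?.
have : g t0 < g t0 / 2 + g t0 / 2; last by lra.
have h (p q e : R) : 0 < e -> -1 <= p -> p <= 1 -> - e < q -> q < e -> - (p * q) < e.
  by move=> *; have [?|?] := leP 0 p; nra.
have h0 := h (cos t) (a 0 0 - y 0 0) (g t0 / 2).
have h1 := h (sin t) (a 0 1 - y 0 1) (g t0 / 2).
have : - (cos t * (a 0 0 - y 0 0)) < g t0 / 2 by apply: h0 => //; lra.
have : - (sin t * (a 0 1 - y 0 1)) < g t0 / 2 by apply: h1 => //; lra.
lra.
Qed.

Lemma tangent_at_common_point A B t x : compact A -> compact B ->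
  A x -> B x -> dot (dir t) x = supp A t -> dot (dir t) x = supp B t ->
  tangent A B.
Proof.
move=> kA kB Ax Bx eA eB; exists (line (dir t) (dot (dir t) x)); split.
- exists (dir t), (dot (dir t) x); split=> //; first exact: dir_neq0.
    by exists x.
  by left=> y Ay; rewrite eA le_supp.
- exists (dir t), (dot (dir t) x); split=> //; first exact: dir_neq0.
    by exists x.
  by left=> y By; rewrite eB le_supp.
- by exists x.
Qed.

Lemma tangent_line_supp A t : compact A -> A !=set0 ->
  tangent_line (line (dir t) (supp A t)) A.
Proof.
move=> kA A0; exists (dir t), (supp A t); split=> //; first exact: dir_neq0.
  by have [x Ax e] := supp_attained t kA A0; exists x.
by left=> x Ax; exact: le_supp.
Qed.

(** Two extreme points on a common supporting line with equal coordinates along it coincide, and are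
    then a point of tangency. *)
Lemma face_offset_neq0 A B t a b : compact A -> compact B -> ~ tangent A B ->
  A a -> B b -> dot (dir t) a = supp A t -> dot (dir t) b = supp B t ->
  supp A t = supp B t -> dot (dir (t + pi / 2)) (b - a) != 0.
Proof.
move=> kA kB nt Aa Bb ea eb eAB; apply/eqP => e; apply: nt.
have ab : b = a.
  apply/eqP; rewrite -subr_eq0 (dir_frame t (b - a)) e dotBr ea eb eAB subrr.
  by rewrite !scale0r addr0.
by apply: (@tangent_at_common_point A B t a); rewrite // -?ab.
Qed.

(* On the side of [t] towards which the face of [B] is displaced, only the
   points of [A] lying beyond [b] could compete with [b]; they stay away from the
   supporting line, for otherwise [b] would be a point of tangency. *)
Lemma supp_transversal A B t a b : compact A -> convex_set A -> compact B ->
  ~ tangent A B -> A a -> B b ->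
  dot (dir t) a = supp A t -> dot (dir t) b = supp B t -> supp A t = supp B t ->
  exists2 d, 0 < d & forall s, `|s| < d ->
    0 < s * dot (dir (t + pi / 2)) (b - a) -> supp A (t + s) < supp B (t + s).
Proof.
move=> kA cA kB nt Aa Bb ea eb eAB.
set e' := dir (t + pi / 2); set c := dot e' (b - a).
have pi0 := pi_gt0 R.
have A0 : A !=set0 by exists a.
(* The points of [A] at or beyond [b] along the line. For the others, rotating by [s] favours [b],
   and [b] already reaches the maximum at [t]. *)
pose A' := A `&` [set x | 0 <= c * (dot e' x - dot e' b)].
suff [d d0 dP] : exists2 d : R, 0 < d & forall s, `|s| < d -> forall x, A' x ->
    dot (dir (t + s)) x < dot (dir (t + s)) b.
  exists (Num.min d (pi / 2)); first by rewrite lt_min d0 divr_gt0.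
  move=> s; rewrite lt_min => /andP[sd]; rewrite ltr_norml => /andP[s1 s2] sc.
  apply: lt_le_trans (le_supp _ kB Bb); apply: supp_lt => // x Ax.
  have [xA'|xA'] := leP 0 (c * (dot e' x - dot e' b)); first by apply: dP.
  rewrite (dot_dirD t s x) (dot_dirD t s b) -/e'.
  have cs : 0 < cos s by apply: cos_gt0_pihalf; rewrite s1.
  have ss : 0 < sin s * c.
    have [s0|s0|s0] := ltgtP 0 s; last by move: sc; rewrite -s0 mul0r ltxx.
      have c0 : 0 < c by rewrite -(pmulr_rgt0 _ s0).
      by rewrite mulr_gt0// sin_gt0_pi// s0/=; lra.
    have c0 : c < 0 by rewrite -(nmulr_rgt0 _ s0).
    have : 0 < sin (- s) by apply: sin_gt0_pi; apply/andP; split; lra.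
    by rewrite sinN oppr_gt0 => ?; rewrite nmulr_rgt0.
  have cc : 0 < c * c.
    rewrite -expr2 exprn_even_gt0//=; apply: contraTN ss => /eqP ->.
    by rewrite mulr0 ltxx.
  have sD : sin s * (dot e' x - dot e' b) < 0.
    rewrite -(pmulr_rlt0 _ cc) mulrACA [c * sin s]mulrC pmulr_rlt0//.
  have : cos s * dot (dir t) x <= cos s * dot (dir t) b.
    by rewrite ler_pM2l// eb -eAB le_supp.
  by move: sD; rewrite mulrBr; lra.
have kA' : compact A'.
  apply: compact_closedI => //.
  apply: (@preimage_closed _ _ (fun x => c * (dot e' x - dot e' b)) [set r | 0 <= r]).
    move=> x _; rewrite /continuous_at.
    exact: (cvgM (cvg_cst c) (cvgB (@dot_continuous R e' x) (cvg_cst (dot e' b)))).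
  exact: closed_ge.
have [A'0|/set0P A'0] := eqVneq A' set0.
  by exists 1 => // s _ x; rewrite A'0.
have [x0 [Ax0 cx0] x0m] := dot_max (dir t) kA' A'0.
have c0 : c != 0 by exact: (face_offset_neq0 kA kB).
have gap : dot (dir t) x0 < supp A t.
  rewrite lt_neqAle le_supp// andbT; apply/eqP => ex0; apply: nt.
  have w0 : 0 < c * (dot e' x0 - dot e' a).
    have : 0 < c * c by rewrite -expr2 exprn_even_gt0.
    by move: cx0; rewrite /= /c dotBr; lra.
  have D0 : dot e' x0 - dot e' a != 0 by apply: contraTN w0 => /eqP ->; rewrite mulr0 ltxx.
  (* If [x0] were on the supporting line, [b] would divide the segment from [a] to [x0] in this
     ratio and thus belong to [A]. *)
  pose l := c / (dot e' x0 - dot e' a).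
  have lE : l * (dot e' x0 - dot e' a) = c by rewrite /l divfK.
  have Ab : A b.
    have -> : b = l *: x0 + (1 - l) *: a.
      rewrite (dir_frame t b) (dir_frame t (l *: x0 + _)) !dotr ex0 ea eb eAB.
      congr (_ *: _ + _ *: _); first by ring.
      by move: lE; rewrite /c dotBr -/e'; lra.
    apply: convex_comb => //.
    have l0 : 0 <= l.
      have D2 : 0 < (dot e' x0 - dot e' a) ^+ 2 by rewrite exprn_even_gt0.
      by rewrite -(pmulr_lge0 _ D2) expr2 mulrA lE ltW.
    rewrite l0/=; move: cx0 w0; rewrite /= => cx0 w0.
    have : 0 <= c * (dot e' x0 - dot e' a) * (1 - l).
      have -> : c * (dot e' x0 - dot e' a) * (1 - l) = c * (dot e' x0 - dot e' b).
        rewrite -mulrA mulrBr mulr1 [_ * l]mulrC lE /c dotBr; ring.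
      done.
    by rewrite pmulr_rge0// subr_ge0.
  by apply: (@tangent_at_common_point A B t b); rewrite // eb eAB.
have gap2 : 0 < (supp A t - dot (dir t) x0) / 2 by rewrite divr_gt0// subr_gt0.
have [d1 d10 d1P] := dot_dir_equicontinuous t kA gap2.
have [d2 d20 d2P] := dot_dir_equicontinuous t kB gap2.
exists (Num.min d1 d2); first by rewrite lt_min d10.
move=> s; rewrite lt_min => /andP[s1 s2] x [Ax xc].
have := d1P (t + s) _ _ Ax; have := d2P (t + s) _ _ Bb.
rewrite addrAC subrr add0r => /(_ s2) + /(_ s1).
rewrite !ltr_norml eb -eAB => /andP[? ?] /andP[? ?].
have : dot (dir t) x <= dot (dir t) x0 by apply: x0m.
lra.
Qed.

End Support.

(** * Cyclic order of supporting directions *)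

Section Orientation.
Variable R : realType.
Implicit Types (u x y z a b : plane R) (A B K : set (plane R)) (t s c l : R).

(** Expresses [dir z] through [dir x] and [dir y]; without division the identity also covers
    parallel directions. *)
Lemma dot_dir_between (x y z : R) (w : plane R) :
  sin (y - x) * dot (dir z) w =
  sin (y - z) * dot (dir x) w + sin (z - x) * dot (dir y) w.
Proof. by rewrite !dot_dir !sinB; ring. Qed.

(* If [t] lies in an arc of length at most [pi] from [x] to [y], then [dir t] is a
   nonnegative combination of [dir x] and [dir y]. *)
Lemma dot_dir_arc_le (x y t : R) (w : plane R) : x <= t < y -> y - x <= pi ->
  dot (dir x) w <= 0 -> dot (dir y) w < 0 -> dot (dir t) w <= 0.
Proof.
move=> /andP[xt ty]; rewrite le_eqVlt => /orP[/eqP yx|yx] wx /[dup] /ltW wy' wy.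
  have e : y = x + pi by lra.
  by move: wy; rewrite e dirDpi dotNl; lra.
have s0 : 0 < sin (y - x) by apply: sin_gt0_pi; apply/andP; split; lra.
have s1 : 0 <= sin (t - x) by apply: sin_ge0_pi; apply/andP; split; lra.
have s2 : 0 <= sin (y - t) by apply: sin_ge0_pi; apply/andP; split; lra.
rewrite -(pmulr_rle0 _ s0) dot_dir_between.
have := mulr_ge0_le0 s2 wx; have := mulr_ge0_le0 s1 wy'; lra.
Qed.

(** Mirror image of [dot_dir_arc_le], with the strict sign at the start. An arc of length exactly
    [pi] is contradictory, as opposite directions give opposite values. *)
Lemma dot_dir_arc_ge (x y t : R) (w : plane R) : x < t <= y -> y - x <= pi ->
  dot (dir x) w < 0 -> dot (dir y) w <= 0 -> dot (dir t) w <= 0.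
Proof.
move=> /andP[xt ty]; rewrite le_eqVlt => /orP[/eqP yx|yx] wx wy.
  have e : y = x + pi by lra.
  by move: wy; rewrite e dirDpi dotNl; lra.
have s0 : 0 < sin (y - x) by apply: sin_gt0_pi; apply/andP; split; lra.
have s1 : 0 <= sin (t - x) by apply: sin_ge0_pi; apply/andP; split; lra.
have s2 : 0 <= sin (y - t) by apply: sin_ge0_pi; apply/andP; split; lra.
rewrite -(pmulr_rle0 _ s0) dot_dir_between.
have := mulr_ge0_le0 s2 (ltW wx); have := mulr_ge0_le0 s1 wy; lra.
Qed.

(** Here [dir p] is normal to the chord from [bx] to [by_]. If [a] were not beyond the chord, [t]
    would lie between [p] and one of the ends with no positive value at either, forcing a
    nonpositive value at [t]. *)
Lemma beyond_chord (x t y p : R) (a bx by_ : plane R) :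
  x < t < y -> x <= p <= y -> y - p <= pi -> p - x <= pi ->
  dot (dir x) (a - bx) < 0 -> dot (dir y) (a - by_) < 0 ->
  0 < dot (dir t) (a - bx) -> 0 < dot (dir t) (a - by_) ->
  dot (dir p) bx = dot (dir p) by_ -> 0 < dot (dir p) (a - bx).
Proof.
move=> /andP[xt ty] /andP[xp py] yp px ax ay tx ty' e.
rewrite ltNge; apply/negP => ap.
have ap' : dot (dir p) (a - by_) <= 0 by move: ap; rewrite !dotBr e.
have [pt|tp] := leP p t.
  have : dot (dir t) (a - by_) <= 0 by apply: (@dot_dir_arc_le p y) => //; apply/andP.
  by rewrite leNgt ty'.
have : dot (dir t) (a - bx) <= 0.
  by apply: (@dot_dir_arc_ge x p) => //; rewrite xt ltW.
by rewrite leNgt tx.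
Qed.

(* The segment joining the points of [B] extreme in the directions [t2] and [t4]
   separates the points of [A] extreme in the directions [t1] and [t3]. *)
Lemma supp_no_alternation A B (t1 t2 t3 t4 : R) :
  compact A -> convex_body B -> A !=set0 -> B !=set0 -> connected (A `\` B) ->
  t1 < t2 -> t2 < t3 -> t3 < t4 -> t4 < t1 + pi *+ 2 ->
  supp B t1 < supp A t1 -> supp A t2 < supp B t2 ->
  supp B t3 < supp A t3 -> supp A t4 < supp B t4 -> False.
Proof.
move=> kA [kB cB] A0 B0 cAB t12 t23 t34 t41 h1 h2 h3 h4.
have pi0 := pi_gt0 R.
have [a1 Aa1 e1] := supp_attained t1 kA A0.
have [a3 Aa3 e3] := supp_attained t3 kA A0.
have [b2 Bb2 e2] := supp_attained t2 kB B0.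
have [b4 Bb4 e4] := supp_attained t4 kB B0.
have outA t a : supp B t < dot (dir t) a -> forall b, B b -> 0 < dot (dir t) (a - b).
  by move=> ha b Bb; rewrite dotBr subr_gt0; exact: le_lt_trans (le_supp t kB Bb) ha.
have outB t b : supp A t < dot (dir t) b -> forall a, A a -> dot (dir t) (a - b) < 0.
  by move=> hb a Aa; rewrite dotBr subr_lt0; exact: le_lt_trans (le_supp t kA Aa) hb.
have {}h1 : forall b, B b -> 0 < dot (dir t1) (a1 - b) by apply: outA; rewrite e1.
have {}h3 : forall b, B b -> 0 < dot (dir t3) (a3 - b) by apply: outA; rewrite e3.
have {}h2 : forall a, A a -> dot (dir t2) (a - b2) < 0 by apply: outB; rewrite e2.
have {}h4 : forall a, A a -> dot (dir t4) (a - b4) < 0 by apply: outB; rewrite e4.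
have t4P : dir (t4 - pi *+ 2) = dir t4 by rewrite -[in RHS](subrK (pi *+ 2) t4) dir_periodic.
(* For a degenerate chord, one of the two arcs between [t2] and [t4] has length at most [pi], and
   the point of [A] extreme inside it gives the contradiction. *)
have [bb|bb] := eqVneq b2 b4.
  have [tt|tt] := leP (t4 - t2) pi.
    have : 0 < dot (dir t2) (a3 - b2).
      apply: (@beyond_chord t2 t3 t4 t2 a3 b2 b2); rewrite ?lexx;
        try lra; try exact: h3; try exact: h2.
      by rewrite bb; exact: h4.
    by rewrite ltNge ltW// h2.
  have : 0 < dot (dir t2) (a1 - b2).
    apply: (@beyond_chord (t4 - pi *+ 2) t1 t2 t2 a1 b2 b2); rewrite ?t4P ?lexx;
      try lra; try exact: h1; try exact: h2.
    by rewrite bb; exact: h4.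
  by rewrite ltNge ltW// h2.
have [p [c [c0 /andP[p1 p2] pE]]] := @polar_window R (b2 - b4) t2 ltac:(by rewrite subr_eq0).
(* Extremality of [b2] and [b4] places the normal [p] on the arc from [t4 - pi *+ 2] to [t2] and the
   opposite normal [p + pi] on the arc from [t2] to [t4]. *)
have d2 : 0 <= sin (t2 - p).
  rewrite -(pmulr_rge0 _ c0) -dot_dir_rot -pE dotBr subr_ge0 e2.
  exact: le_supp.
have d4 : sin (t4 - p) <= 0.
  rewrite -(pmulr_rle0 _ c0) -dot_dir_rot -pE dotBr subr_le0 e4.
  exact: le_supp.
have p3 : t2 - p <= pi.
  rewrite leNgt; apply/negP => ?; have : sin (t2 - p) < 0; last by lra.
  by apply: sin_lt0_pi; apply/andP; split; lra.
have p4 : t4 - pi *+ 2 <= p.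
  rewrite leNgt; apply/negP => ?.
  have : 0 < sin (t4 - pi *+ 2 - p) by apply: sin_gt0_pi; apply/andP; split; lra.
  have e : t4 - p = t4 - pi *+ 2 - p + pi *+ 2 by ring.
  by move: d4; rewrite e sinD2pi; lra.
have p5 : p <= t4 - pi.
  rewrite leNgt; apply/negP => ?.
  have : 0 < sin (t4 - p) by apply: sin_gt0_pi; apply/andP; split; lra.
  by rewrite ltNge d4.
have pb : dot (dir p) b4 = dot (dir p) b2.
  apply/esym/eqP; rewrite -subr_eq0 -dotBr pE dot_dir_rot subrr sin0 mulr0//.
have s1 : 0 < dot (dir p) (a1 - b4).
  apply: (@beyond_chord (t4 - pi *+ 2) t1 t2 p a1 b4 b2); rewrite ?t4P; try lra;
  [exact: h4|exact: h2|exact: h1|exact: h1].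
have s3 : 0 < dot (dir (p + pi)) (a3 - b2).
  apply: (@beyond_chord t2 t3 t4 (p + pi) a3 b2 b4); try lra;
  [exact: h2|exact: h4|exact: h3|exact: h3|].
  by rewrite dirDpi !dotNl pb.
(* [a1] and [a3] lie strictly on different sides of the line through [b2] and [b4], so the connected
   set [A] minus [B] meets it. The bounds on [A] at [t2] and [t4] confine that point to the chord,
   hence to [B]. *)
have [x [Ax nBx] xE] : exists2 x, (A `\` B) x & dot (dir p) x = dot (dir p) b2.
  have cd : {within A `\` B, continuous (dot (dir p))}.
    by apply: continuous_subspaceT; exact: dot_continuous.
  have /connected_intervalP itv := connected_continuous_connected cAB cd.
  have [|||x ABx xE] := itv (dot (dir p) a3) (dot (dir p) a1) _ _ (dot (dir p) b2).
  - exists a3 => //; split=> // Ba3; by have := h3 _ Ba3; rewrite dotBr subrr ltxx.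
  - exists a1 => //; split=> // Ba1; by have := h1 _ Ba1; rewrite dotBr subrr ltxx.
  - by move: s1 s3; rewrite dirDpi dotNl !dotBr pb; lra.
  by exists x.
apply: nBx.
pose l := dot (dir (p + pi / 2)) (x - b4) / c.
have xl : x = b4 + l *: (b2 - b4).
  suff <- : x - b4 = l *: (b2 - b4) by rewrite addrC subrK.
  rewrite [LHS](dir_frame p) dotBr xE pb subrr scale0r add0r pE scalerA.
  by rewrite /l divfK// gt_eqF.
have l0 : 0 <= l.
  rewrite leNgt; apply/negP => l0; have := h4 _ Ax.
  by rewrite xl addrAC subrr add0r dotZr pE dot_dir_rot ltNge mulr_le0 ?(ltW l0)// pmulr_rle0.
have l1 : l <= 1.
  rewrite leNgt; apply/negP => l1; have := h2 _ Ax.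
  have -> : x - b2 = (l - 1) *: (b2 - b4).
    by rewrite xl; apply: planeP; rewrite !mxE; ring.
  by rewrite dotZr pE dot_dir_rot ltNge mulr_ge0 ?subr_ge0 ?(ltW l1)// pmulr_rge0.
rewrite xl (_ : _ + _ = l *: b2 + (1 - l) *: b4).
  by apply: convex_comb => //; rewrite l0.
by apply: planeP; rewrite !mxE; ring.
Qed.

Lemma ccw_chord (a1 a2 : plane R) (p c : R) a3 : a2 - a1 = c *: dir (p + pi / 2) ->
  ccw_points a1 a2 a3 <-> 0 < - (c * dot (dir p) (a3 - a1)).
Proof.
move=> pE; rewrite /ccw_points.
have -> : a2 0 0 - a1 0 0 = - (c * sin p).
  by have := congr1 (fun v : plane R => v 0 0) pE; rewrite !mxE /= cosDpihalf => ->; ring.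
have -> : a2 0 1 - a1 0 1 = c * cos p.
  by have := congr1 (fun v : plane R => v 0 1) pE; rewrite !mxE /= sinDpihalf => ->; ring.
rewrite dot_dir !mxE.
rewrite (_ : - (c * (cos p * (a3 0 0 - a1 0 0) + sin p * (a3 0 1 - a1 0 1))) =
  - (c * sin p) * (a3 0 1 - a1 0 1) - c * cos p * (a3 0 0 - a1 0 0))//.
ring.
Qed.

(** Angles are measured from the right-hand normal [p] of the edge from [a1] to [a2]: the direction
    of [a2] falls in the first half turn, that of [a1] in the second, and that of [a3] between them.
    This is why the order starts with the second point. *)
Lemma support_order (a1 a2 a3 : plane R) (s1 s2 s3 : R) : ccw_points a1 a2 a3 ->
  dot (dir s1) a2 <= dot (dir s1) a1 -> dot (dir s1) a3 <= dot (dir s1) a1 ->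
  dot (dir s2) a1 <= dot (dir s2) a2 -> dot (dir s2) a3 <= dot (dir s2) a2 ->
  dot (dir s3) a1 <= dot (dir s3) a3 -> dot (dir s3) a2 <= dot (dir s3) a3 ->
  exists z1 z2 z3 : int,
    let t1 := s1 + (pi *+ 2) *~ z1 in
    let t2 := s2 + (pi *+ 2) *~ z2 in
    let t3 := s3 + (pi *+ 2) *~ z3 in
    [/\ t2 <= t3, t3 <= t1 & t1 <= t2 + pi *+ 2].
Proof.
have L u x y : dot u y <= dot u x -> dot u (y - x) <= 0 by rewrite dotBr subr_le0.
move=> ccw /L h12 /L h13 /L h21 /L h23 /L h31 /L h32.
have pi0 := pi_gt0 R.
have P0 : 0 < pi *+ 2 :> R by rewrite mulrn_wgt0.
have a12 : a2 - a1 != 0.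
  by rewrite subr_eq0; apply: contraTN ccw => /eqP ->;
    rewrite /ccw_points !subrr !mul0r subrr ltxx.
have [p [c [c0 _ pE]]] := @polar_window R (a2 - a1) 0 a12.
have p31 : dot (dir p) (a3 - a1) < 0.
  by move/(ccw_chord _ pE): ccw; rewrite oppr_gt0 pmulr_rlt0.
have p32 : dot (dir p) (a3 - a2) < 0.
  have : dot (dir p) (a2 - a1) = 0 by rewrite pE dot_dir_rot subrr sin0 mulr0.
  by move: p31; rewrite !dotBr; lra.
have dirz s (z : int) : dir (s + (pi *+ 2) *~ z) = dir s.
  by apply: (periodicz (f := @dir R)) => ?; exact: dir_periodic.
have [z2 /andP[u21 u22]] := shift_into_window s2 p P0.
have [z1' /andP[u11 u12]] := shift_into_window (- s1) (- p - pi *+ 2) P0.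
have [z3 /andP[u31 u32]] := shift_into_window s3 p P0.
exists (- z1'), z2, z3; rewrite mulrNz.
have e1 : s1 - pi *+ 2 *~ z1' = s1 + (pi *+ 2) *~ (- z1') by rewrite mulrNz.
move: h12 h13 h21 h23 h31 h32.
rewrite -(dirz s1 (- z1')) -e1 -(dirz s2 z2) -(dirz s3 z3).
have {u12} u12 : p < s1 - pi *+ 2 *~ z1' by lra.
have {u11} u11 : s1 - pi *+ 2 *~ z1' <= p + pi *+ 2 by lra.
move: u21 u22 u11 u12 u31 u32; set t1 := s1 - _; set t2 := s2 + _; set t3 := s3 + _.
clearbody t1 t2 t3 => u21 u22 u11 u12 u31 u32 h12 h13 h21 h23 h31 h32 /=.
have k2 : t2 - p <= pi.
  rewrite leNgt; apply/negP => ?.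
  have : 0 < c * sin (t2 - p).
    rewrite -dot_dir_rot -pE; move: h21; rewrite !dotBr.
    have : c * sin (t2 - p) < 0.
      by rewrite pmulr_rlt0//; apply: sin_lt0_pi; apply/andP; split; lra.
    by rewrite -dot_dir_rot -pE dotBr; lra.
  have : sin (t2 - p) < 0 by apply: sin_lt0_pi; apply/andP; split; lra.
  by rewrite pmulr_rgt0//; lra.
have k1 : pi <= t1 - p.
  rewrite leNgt; apply/negP => ?.
  have : 0 < sin (t1 - p) by apply: sin_gt0_pi; apply/andP; split; lra.
  by rewrite -(pmulr_rgt0 _ c0) -dot_dir_rot -pE; lra.
split; last by lra.
  (* If [t3] came before [t2], [dir t3] would be a positive combination of [dir p] and [dir t2],
     making [a3] fall below [a2] in direction [t3]. *)
  rewrite leNgt; apply/negP => t32.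
  have [t3p|t3p] := eqVneq t3 p; 
    first by move: h31 p31; rewrite t3p !dotBr; lra.
  have t3p' : p < t3 by rewrite lt_neqAle eq_sym t3p.
  have [kp|kp] := eqVneq (t2 - p) pi.
    have e : t2 = p + pi by lra.
    by move: h23; rewrite e dirDpi dotNl; lra.
  have kp' : t2 - p < pi by rewrite lt_neqAle kp.
  have := dot_dir_between p t2 t3 (a3 - a2).
  have : 0 < sin (t2 - p) by apply: sin_gt0_pi; apply/andP; split; lra.
  have : 0 < sin (t2 - t3) by apply: sin_gt0_pi; apply/andP; split; lra.
  have : 0 < sin (t3 - p) by apply: sin_gt0_pi; apply/andP; split; lra.
  by move: h32 h23 p32; rewrite !dotBr; nra.
rewrite leNgt; apply/negP => t31.
have [kp|kp] := eqVneq (t1 - p) pi.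
  have e : t1 = p + pi by lra.
  by move: h13; rewrite e dirDpi dotNl; lra.
have kp' : pi < t1 - p by rewrite lt_neqAle eq_sym kp.
have := dot_dir_between t1 (p + pi *+ 2) t3 (a3 - a1); rewrite dir_periodic.
have : 0 < sin (p + pi *+ 2 - t1) by apply: sin_gt0_pi; apply/andP; split; lra.
have : 0 < sin (p + pi *+ 2 - t3) by apply: sin_gt0_pi; apply/andP; split; lra.
have : 0 < sin (t3 - t1) by apply: sin_gt0_pi; apply/andP; split; lra.
by move: h31 h13 p31; rewrite !dotBr; nra.
Qed.

End Orientation.

(** * Oriented triples *)

Section Triples.
Variable R : realType.
Implicit Types (u x y z a b : plane R) (A B C K : set (plane R)) (t s : R).

Lemma tangent_sym A B : tangent A B -> tangent B A.
Proof. by move=> [l [? ? ?]]; exists l; split; rewrite // setIC [B `&` A]setIC -setIC. Qed.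

(** The sign of the offset between the two faces tells on which side of [t] the support of [B] is
    larger. *)
Lemma supp_cross A B t (d : R) : convex_body A -> compact B ->
  A !=set0 -> B !=set0 -> ~ tangent A B -> supp A t = supp B t -> 0 < d ->
  exists2 t', `|t' - t| < d & supp A t' < supp B t'.
Proof.
move=> [kA cA] kB A0 B0 nt e d0.
have [a Aa ea] := supp_attained t kA A0.
have [b Bb eb] := supp_attained t kB B0.
have := face_offset_neq0 kA kB nt Aa Bb ea eb e.
have [d' d'0] := supp_transversal kA cA kB nt Aa Bb ea eb e.
set c := dot _ _ => dP c0.
pose m := Num.min d d' / 2.
have m0 : 0 < m by rewrite divr_gt0// lt_min d0.
have [md md'] : m < d /\ m < d'.
  by rewrite /m; have [?|?] := leP d d'; split; lra.
have [cp|cn|ce] := ltgtP 0 c; last by rewrite -ce eqxx in c0.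
  exists (t + m); first by rewrite addrAC subrr add0r gtr0_norm.
  by apply: dP; [rewrite gtr0_norm | rewrite mulr_gt0].
exists (t - m); first by rewrite addrAC subrr add0r normrN gtr0_norm.
by apply: dP; [rewrite normrN gtr0_norm | rewrite nmulr_lgt0// oppr_lt0].
Qed.

Definition strict_triple A B C := exists t1 t2 t3 : R,
  [/\ t1 < t2, t2 < t3 & t3 < t1 + pi *+ 2] /\
  [/\ supp B t1 < supp A t1, supp C t1 < supp A t1,
      supp A t2 < supp B t2, supp C t2 < supp B t2 &
      supp A t3 < supp C t3 /\ supp B t3 < supp C t3].

Lemma strict_triple_rot A B C : strict_triple A B C -> strict_triple B C A.
Proof.
move=> [t1 [t2 [t3 [[? ? ?] [? ? ? ? [? ?]]]]]].
exists t2, t3, (t1 + pi *+ 2); split; first by split=> //; lra.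
by split=> //; rewrite !supp_periodic.
Qed.

Definition no_common_tangent A B C :=
  ~ exists l, [/\ tangent_line l A, tangent_line l B & tangent_line l C].

Lemma no_common_tangent_rot A B C : no_common_tangent A B C -> no_common_tangent B C A.
Proof. by move=> h [l [? ? ?]]; apply: h; exists l. Qed.

Lemma no_common_tangent_supp A B C t : compact A -> compact B -> compact C ->
  A !=set0 -> B !=set0 -> C !=set0 -> no_common_tangent A B C ->
  supp A t = supp B t -> supp A t = supp C t -> False.
Proof.
move=> kA kB kC A0 B0 C0 nct eB eC; apply: nct.
exists (line (dir t) (supp A t)); split; first exact: tangent_line_supp.
  by rewrite eB; exact: tangent_line_supp.
by rewrite eC; exact: tangent_line_supp.
Qed.

Definition generic_bodies A B C :=
  [/\ [/\ convex_body A, convex_body B & convex_body C],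
      [/\ A !=set0, B !=set0 & C !=set0],
      [/\ ~ tangent A B, ~ tangent B C & ~ tangent C A] &
      no_common_tangent A B C].

Lemma generic_bodies_rot A B C : generic_bodies A B C -> generic_bodies B C A.
Proof.
by move=> [[? ? ?] [? ? ?] [? ? ?] /no_common_tangent_rot].
Qed.

Lemma supp_near_lt A B t : convex_body A -> convex_body B -> A !=set0 -> B !=set0 ->
  supp A t < supp B t ->
  exists2 d, 0 < d & forall s, `|s - t| < d -> supp A s < supp B s.
Proof.
move=> [kA _] [kB _] A0 B0 h; apply: near_eps; apply: continuous_near_lt => //.
  exact: supp_continuous.
exact: supp_continuous.
Qed.

(** At most one of the two inequalities is an equality, for otherwise the three bodies share a
    supporting line. That tie is broken within a neighbourhood where the other inequality stays
    strict. *)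
Lemma perturb_strict A B C t (d : R) : generic_bodies A B C -> 0 < d ->
  supp B t <= supp A t -> supp C t <= supp A t ->
  exists2 t', `|t' - t| < d & supp B t' < supp A t' /\ supp C t' < supp A t'.
Proof.
move=> [[bA bB bC] [A0 B0 C0] [tAB tBC tCA] nct] d0.
have tBA : ~ tangent B A by move/tangent_sym.
rewrite le_eqVlt => /orP[/eqP eB|hB]; rewrite le_eqVlt => /orP[/eqP eC|hC].
- by have [] := @no_common_tangent_supp A B C t bA.1 bB.1 bC.1 A0 B0 C0 nct.
- have [d' d'0 dP] := supp_near_lt bC bA C0 A0 hC.
  have dd : 0 < Num.min d d' by rewrite lt_min d0.
  have [t'] := supp_cross bB bA.1 B0 A0 tBA eB dd.
  by rewrite lt_min => /andP[? /dP ?] ?; exists t'.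
- have [d' d'0 dP] := supp_near_lt bB bA B0 A0 hB.
  have dd : 0 < Num.min d d' by rewrite lt_min d0.
  have [t'] := supp_cross bC bA.1 C0 A0 tCA eC dd.
  by rewrite lt_min => /andP[? /dP ?] ?; exists t'.
- by exists t => //; rewrite subrr normr0.
Qed.

Lemma strict_triple_distinct A B C (t1 t2 t3 : R) : generic_bodies A B C ->
  t1 < t2 -> t2 < t3 -> t3 < t1 + pi *+ 2 ->
  supp B t1 <= supp A t1 -> supp C t1 <= supp A t1 ->
  supp A t2 <= supp B t2 -> supp C t2 <= supp B t2 ->
  supp A t3 <= supp C t3 -> supp B t3 <= supp C t3 ->
  strict_triple A B C.
Proof.
move=> g t12 t23 t31 hBA hCA hAB hCB hAC hBC.
have g2 := generic_bodies_rot g; have g3 := generic_bodies_rot g2.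
pose d := Num.min (t2 - t1) (Num.min (t3 - t2) (t1 + pi *+ 2 - t3)) / 2.
have d0 : 0 < d by rewrite divr_gt0// !lt_min !subr_gt0 t12 t23.
have [d1 [d2 d3]] : 2 * d <= t2 - t1 /\ 2 * d <= t3 - t2 /\ 2 * d <= t1 + pi *+ 2 - t3.
  have -> : 2 * d = Num.min (t2 - t1) (Num.min (t3 - t2) (t1 + pi *+ 2 - t3)).
    by rewrite /d; field.
  by rewrite !ge_min !lexx !orbT.
have [u1 + [? ?]] := perturb_strict g d0 hBA hCA.
have [u2 + [? ?]] := perturb_strict g2 d0 hCB hAB.
have [u3 + [? ?]] := perturb_strict g3 d0 hAC hBC.
rewrite !ltr_norml => /andP[? ?] /andP[? ?] /andP[? ?].
by exists u1, u2, u3; split; split=> //; lra.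
Qed.

(** The orientation of [a], [b], [c] puts [b] ahead of [a] on the common supporting line, so [A] is
    on top just before [t] and [B] just after. *)
Lemma strict_triple_tie A B C a b c (t t3 : R) : generic_bodies A B C ->
  t < t3 -> t3 < t + pi *+ 2 ->
  ccw_points a b c -> A a -> B b -> C c ->
  dot (dir t) a = supp A t -> dot (dir t) b = supp B t -> supp A t = supp B t ->
  supp C t <= supp A t ->
  supp A t3 <= supp C t3 -> supp B t3 <= supp C t3 ->
  strict_triple A B C.
Proof.
move=> g tt3 t3t ccw Aa Bb Cc ea eb e hCA hAC hBC.
have g3 := generic_bodies_rot (generic_bodies_rot g).
have [[bA bB bC] [A0 B0 C0] [tAB tBC tCA] nct] := g.
have tBA : ~ tangent B A by move/tangent_sym.
have hCA' : supp C t < supp A t.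
  rewrite lt_neqAle hCA andbT; apply/eqP => eC.
  exact: (@no_common_tangent_supp A B C t bA.1 bB.1 bC.1 A0 B0 C0 nct).
have hCB' : supp C t < supp B t by rewrite -e.
pose k := dot (dir (t + pi / 2)) (b - a).
have ab : b - a = k *: dir (t + pi / 2).
  rewrite {1}(dir_frame t (b - a)) (_ : dot (dir t) _ = 0) ?scale0r ?add0r//.
  by rewrite dotBr ea eb e subrr.
have k0 : 0 < k.
  move/(ccw_chord _ ab): ccw; have : dot (dir t) (c - a) <= 0.
    by rewrite dotBr subr_le0 ea; exact: le_trans (le_supp t bC.1 Cc) hCA.
  by nra.
have [d1 d10 d1P] := supp_transversal bA.1 bA.2 bB.1 tAB Aa Bb ea eb e.
have [d2 d20 d2P] := supp_transversal bB.1 bB.2 bA.1 tBA Bb Aa eb ea (esym e).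
have [d3 d30 d3P] := supp_near_lt bC bA C0 A0 hCA'.
have [d4 d40 d4P] := supp_near_lt bC bB C0 B0 hCB'.
pose m := Num.min (Num.min d1 d2) (Num.min (Num.min d3 d4)
  (Num.min (t3 - t) (t + pi *+ 2 - t3))).
have m0 : 0 < m by rewrite !lt_min d10 d20 d30 d40 !subr_gt0 tt3.
have : m <= m by [].
rewrite {2}/m !le_min => /andP[/andP[m1 m2] /andP[/andP[m3 m4] /andP[m5 m6]]].
have dm : 0 < m / 2 by rewrite divr_gt0.
have [u3 + [? ?]] := perturb_strict g3 dm hAC hBC.
rewrite ltr_norml => /andP[? ?].
have nm : `|m / 2| = m / 2 by rewrite gtr0_norm.
exists (t - m / 2), (t + m / 2), u3; split; first by split; lra.
split=> //.
- apply: d2P; first by rewrite normrN nm; lra.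
  rewrite (_ : dot _ _ = - k); first by rewrite mulrNN mulr_gt0.
  by rewrite /k !dotBr; ring.
- by apply: d3P; rewrite addrAC subrr add0r normrN nm; lra.
- by apply: d1P; [rewrite nm; lra | rewrite mulr_gt0].
- by apply: d4P; rewrite addrAC subrr add0r nm; lra.
Qed.

(** Two of the directions may coincide but not all three, which would give a common tangent. Each
    coincidence is a tie up to cyclic rotation, with [pi *+ 2] added to a direction that passes the
    cut. *)
Lemma strict_triple_weak A B C a b c (t1 t2 t3 : R) : generic_bodies A B C ->
  ccw_points a b c -> A a -> B b -> C c ->
  t1 <= t2 -> t2 <= t3 -> t3 <= t1 + pi *+ 2 ->
  dot (dir t1) a = supp A t1 -> dot (dir t2) b = supp B t2 -> dot (dir t3) c = supp C t3 ->
  supp B t1 <= supp A t1 -> supp C t1 <= supp A t1 ->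
  supp A t2 <= supp B t2 -> supp C t2 <= supp B t2 ->
  supp A t3 <= supp C t3 -> supp B t3 <= supp C t3 ->
  strict_triple A B C.
Proof.
move=> g ccw Aa Bb Cc t12 t23 t31 ea eb ec hBA hCA hAB hCB hAC hBC.
have g2 := generic_bodies_rot g; have g3 := generic_bodies_rot g2.
have ccw2 : ccw_points b c a by move: ccw; rewrite /ccw_points; lra.
have ccw3 : ccw_points c a b by move: ccw; rewrite /ccw_points; lra.
have [[bA bB bC] [A0 B0 C0] _ nct] := g.
have dirP t : dir (t + pi *+ 2) = dir t := dir_periodic t.
have P0 : 0 < pi *+ 2 :> R by rewrite mulrn_wgt0// pi_gt0.
have no3 t : supp A t = supp B t -> supp A t = supp C t -> False.
  exact: (@no_common_tangent_supp A B C t bA.1 bB.1 bC.1 A0 B0 C0 nct).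
have [e12|n12] := eqVneq t1 t2.
  have e : supp A t1 = supp B t1 by apply/eqP; rewrite eq_le hBA andbT e12.
  apply: (@strict_triple_tie A B C a b c t1 t3) => //; rewrite ?e12//.
  - rewrite lt_neqAle t23 andbT; apply/eqP => e23; apply: (@no3 t1) => //.
    by apply/eqP; rewrite eq_le hCA e12 e23 hAC.
  - rewrite lt_neqAle -{2}e12 t31 andbT; apply/eqP => e31; apply: (@no3 t1) => //.
    by apply/eqP; rewrite eq_le hCA andbT; move: hAC; rewrite e31 !supp_periodic e12.
have {n12} t12' : t1 < t2 by rewrite lt_neqAle n12.
have [e23|n23] := eqVneq t2 t3.
  have e : supp B t2 = supp C t2 by apply/eqP; rewrite eq_le hCB andbT e23.
  apply: strict_triple_rot; apply: strict_triple_rot.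
  apply: (@strict_triple_tie B C A b c a t2 (t1 + pi *+ 2)) => //; rewrite ?supp_periodic//; try lra.
  - rewrite lt_neqAle e23 t31 andbT; apply/eqP => e31.
    apply: (@no3 t2); last by rewrite -e; apply/eqP; rewrite eq_le hAB/= e23 e31 !supp_periodic.
    by apply/eqP; rewrite eq_le hAB/= e23 e31 !supp_periodic.
  - by rewrite e23.
have {n23} t23' : t2 < t3 by rewrite lt_neqAle n23.
have [e31|n31] := eqVneq t3 (t1 + pi *+ 2).
  have e : supp C t3 = supp A t3 by apply/eqP; rewrite eq_le hAC andbT e31 !supp_periodic.
  apply: strict_triple_rot.
  apply: (@strict_triple_tie C A B c a b t3 (t2 + pi *+ 2)) => //; rewrite ?supp_periodic//; try lra.
  by rewrite e31 dirP supp_periodic.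
apply: (strict_triple_distinct g t12' t23') => //.
by rewrite lt_neqAle n31.
Qed.

Lemma ccw_oriented_strict A B C :
  convex_body A -> convex_body B -> convex_body C ->
  ~ tangent A B -> ~ tangent B C -> ~ tangent C A -> no_common_tangent A B C ->
  ccw_oriented A B C -> strict_triple A B C.
Proof.
move=> bA bB bC tAB tBC tCA nct [a [b [c [[Aa ba] [Bb bb] [Cc bc] ccw]]]].
set K := convex_hull _ in ba bb bc.
have kK : compact K.
  have -> : K = convex_hull (\bigcup_(X in [set` [:: A; B; C]]) X).
    congr convex_hull; apply/seteqP; split=> x.
      by move=> [[Ax|Bx]|Cx]; [exists A|exists B|exists C] => //=; rewrite !inE eqxx ?orbT.
    by move=> [X /=]; rewrite !inE => /or3P[] /eqP -> ?; [left; left|left; right|right].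
  by apply: convex_hull_finite_compact => X; rewrite !inE => /or3P[] /eqP ->.
have cK : convex_set K by exact: convex_hull_convex.
have AK : A `<=` K by move=> x Ax; apply: sub_convex_hull; left; left.
have BK : B `<=` K by move=> x Bx; apply: sub_convex_hull; left; right.
have CK : C `<=` K by move=> x Cx; apply: sub_convex_hull; right.
have [s1 h1] := supporting_direction kK cK (AK _ Aa) ba.2.
have [s2 h2] := supporting_direction kK cK (BK _ Bb) bb.2.
have [s3 h3] := supporting_direction kK cK (CK _ Cc) bc.2.
have [||||||z1 [z2 [z3 o]]] := @support_order R a b c s1 s2 s3 ccw.
- by apply: h1; apply: BK.
- by apply: h1; apply: CK.
- by apply: h2; apply: AK.
- by apply: h2; apply: CK.
- by apply: h3; apply: AK.
- by apply: h3; apply: BK.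
move: o => /= [q1 q2 q3].
have dirz s (z : int) : dir (s + (pi *+ 2) *~ z) = dir s.
  by apply: (periodicz (f := @dir R)) => ?; exact: dir_periodic.
rewrite -(dirz _ z1) in h1; rewrite -(dirz _ z2) in h2; rewrite -(dirz _ z3) in h3.
set t1 := s1 + _ in q1 q2 q3 h1; set t2 := s2 + _ in q1 q2 q3 h2; set t3 := s3 + _ in q1 q2 q3 h3.
have A0 : A !=set0 by exists a.
have B0 : B !=set0 by exists b.
have C0 : C !=set0 by exists c.
have supK X t r : compact X -> X !=set0 -> X `<=` K ->
    (forall y, K y -> dot (dir t) y <= r) -> supp X t <= r.
  by move=> kX X0 XK Kr; have [x Xx <-] := supp_attained t kX X0; by apply: Kr; apply: XK.
have e1 : dot (dir t1) a = supp A t1.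
  by apply/eqP; rewrite eq_le (le_supp _ bA.1)//= supK//; exact: bA.1.
have e2 : dot (dir t2) b = supp B t2.
  by apply/eqP; rewrite eq_le (le_supp _ bB.1)//= supK//; exact: bB.1.
have e3 : dot (dir t3) c = supp C t3.
  by apply/eqP; rewrite eq_le (le_supp _ bC.1)//= supK//; exact: bC.1.
have g : generic_bodies A B C by [].
(* The directions come in the order of [B], [C], [A]; two rotations lead back. *)
apply: strict_triple_rot; apply: strict_triple_rot.
apply: (@strict_triple_weak B C A b c a t2 t3 t1) => //; first exact: generic_bodies_rot.
- by move: ccw; rewrite /ccw_points; lra.
- by rewrite -e2 supK//; exact: bC.1.
- by rewrite -e2 supK//; exact: bA.1.
- by rewrite -e3 supK//; exact: bB.1.
- by rewrite -e3 supK//; exact: bA.1.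
- by rewrite -e1 supK//; exact: bB.1.
- by rewrite -e1 supK//; exact: bC.1.
Qed.

End Triples.

(** * Convex position *)

Section ConvexPosition.
Variable R : realType.
Implicit Types (p x y : plane R) (A B C K : set (plane R)) (t : R)
  (F : set (set (plane R))) (s : seq (set (plane R))).

(** By [t1] both other points lie on the same side of [p1]; then [t2] makes [p2] the farther one and
    [t3] makes it [p3]. *)
Lemma collinear_not_exposed (p1 p2 p3 : plane R) (t1 t2 t3 : R) :
  (p2 0 0 - p1 0 0) * (p3 0 1 - p1 0 1) - (p2 0 1 - p1 0 1) * (p3 0 0 - p1 0 0) = 0 ->
  dot (dir t1) p2 < dot (dir t1) p1 -> dot (dir t1) p3 < dot (dir t1) p1 ->
  dot (dir t2) p1 < dot (dir t2) p2 -> dot (dir t2) p3 < dot (dir t2) p2 ->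
  dot (dir t3) p1 < dot (dir t3) p3 -> dot (dir t3) p2 < dot (dir t3) p3 -> False.
Proof.
move=> D0 h12 h13 h21 h23 h31 h32.
have prop t t' : dot (dir t) (p2 - p1) * dot (dir t') (p3 - p1) =
                 dot (dir t) (p3 - p1) * dot (dir t') (p2 - p1).
  apply/eqP; rewrite -subr_eq0 !dot_dir !mxE.
  set v0 := p2 0 0 - _ in D0 *; set v1 := p2 0 1 - _ in D0 *.
  set w0 := p3 0 0 - _ in D0 *; set w1 := p3 0 1 - _ in D0 *.
  have -> : (cos t * v0 + sin t * v1) * (cos t' * w0 + sin t' * w1) -
    (cos t * w0 + sin t * w1) * (cos t' * v0 + sin t' * v1) =
    (cos t * sin t' - sin t * cos t') * (v0 * w1 - v1 * w0) by ring.
  by rewrite D0 mulr0.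
have := prop t1 t2; have := prop t1 t3; rewrite !dotBr.
set a := dot (dir t1) p2 - _; set b := dot (dir t1) p3 - _.
set v2 := dot (dir t2) p2 - _; set w2 := dot (dir t2) p3 - _.
set v3 := dot (dir t3) p2 - _; set w3 := dot (dir t3) p3 - _.
have a0 : a < 0 by rewrite subr_lt0.
have b0 : b < 0 by rewrite subr_lt0.
have v20 : 0 < v2 by rewrite subr_gt0.
have w30 : 0 < w3 by rewrite subr_gt0.
have vw2 : w2 < v2 by rewrite ltrD2r.
have vw3 : v3 < w3 by rewrite ltrD2r.
move=> e3 e2.
have ab : a < b by rewrite -(ltr_pM2r v20) -e2 ltr_nM2l.
have v30 : 0 < v3 by rewrite -(nmulr_rlt0 _ b0) -e3 nmulr_rlt0.
have : b < a by rewrite -(ltr_pM2r v30) -e3 ltr_nM2l.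
by rewrite ltNge ltW.
Qed.

(** Otherwise [p1], [p3], [p2] is counterclockwise, and the reversed cyclic order of directions
    forces [z3 + 1 <= z2] and [z2 + 1 <= z1]: two full turns where only one is available. *)
Lemma exposed_ccw (p1 p2 p3 : plane R) (t1 t2 t3 : R) :
  t1 < t2 -> t2 < t3 -> t3 < t1 + pi *+ 2 ->
  dot (dir t1) p2 < dot (dir t1) p1 -> dot (dir t1) p3 < dot (dir t1) p1 ->
  dot (dir t2) p1 < dot (dir t2) p2 -> dot (dir t2) p3 < dot (dir t2) p2 ->
  dot (dir t3) p1 < dot (dir t3) p3 -> dot (dir t3) p2 < dot (dir t3) p3 ->
  ccw_points p1 p2 p3.
Proof.
move=> t12 t23 t31 h12 h13 h21 h23 h31 h32; apply: contrapT => nccw.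
have P0 : 0 < pi *+ 2 :> R by rewrite mulrn_wgt0// pi_gt0.
have ccw' : ccw_points p1 p3 p2.
  have D0 := @collinear_not_exposed p1 p2 p3 t1 t2 t3 _ h12 h13 h21 h23 h31 h32.
  rewrite /ccw_points ltNge; apply/negP => le0.
  apply: D0; apply/eqP; rewrite eq_le; apply/andP; split.
    by rewrite leNgt; apply/negP.
  lra.
have [||||||z1 [z3 [z2 /=]]] := @support_order R p1 p3 p2 t1 t3 t2 ccw'; try exact: ltW.
rewrite -(mulrzr _ z1) -(mulrzr _ z2) -(mulrzr _ z3) => -[u1 u2 u3].
have step (a b : int) : 0 < (pi *+ 2) * (b%:~R - a%:~R) :> R -> a%:~R + 1 <= b%:~R :> R.
  by rewrite pmulr_rgt0// subr_gt0 ltr_int -lezD1 -(ler_int R) intrD.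
have s32 : z3%:~R + 1 <= z2%:~R :> R by apply: step; lra.
have s21 : z2%:~R + 1 <= z1%:~R :> R by apply: step; lra.
have : (pi *+ 2) * (z3%:~R + 2) <= (pi *+ 2) * z1%:~R :> R by rewrite ler_pM2l//; lra.
lra.
Qed.

Lemma exposed_boundary K p t : K p ->
  (forall y, K y -> dot (dir t) y <= dot (dir t) p) -> boundary K p.
Proof.
move=> Kp pmax; split; first exact: subset_closure.
move=> /nbhs_ballP[e /= e0 eK].
(* A small step outward from [p] in direction [dir t] would stay in [K] and exceed the maximum. *)
have : K (p + (e / 2) *: dir t).
  apply: eK; rewrite -ball_normE /= opprD addrA subrr add0r normrN normrZ.
  have d1 : `|dir t| <= 1.
    rewrite [leLHS]/Num.Def.normr /= mx_normrE; apply/bigmax_leP; split=> // -[i j] _ /=.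
    by rewrite mxE; case: ifP => _; [exact: cos_max | exact: sin_max].
  by rewrite ger0_norm ?divr_ge0 ?(ltW e0)//; nra.
move=> /pmax; rewrite dotr dotr (_ : dot (dir t) (dir t) = 1); last first.
  by rewrite dot_dir dir0 dir1 -!expr2 cos2Dsin2.
lra.
Qed.

Lemma visible_hull_neq F A t : F A -> compact A -> A !=set0 ->
  (forall B x, F B -> B <> A -> B x -> dot (dir t) x < supp A t) ->
  convex_hull (\bigcup_(B in F) B) <> convex_hull (\bigcup_(B in F `\ A) B).
Proof.
move=> FA kA A0 below e; have [a Aa ea] := supp_attained t kA A0.
have : convex_hull (\bigcup_(B in F `\ A) B) a.
  by rewrite -e; apply: sub_convex_hull; exists A.
have sub : convex_hull (\bigcup_(B in F `\ A) B) `<=` [set x | dot (dir t) x < supp A t].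
  apply: convex_hull_min; first exact: convex_halfplane_lt.
  by move=> x [B [FB BA] Bx]; exact: below FB BA Bx.
by move=> /sub /=; rewrite ea ltxx.
Qed.

(** Some point of [A] lies outside the compact hull of the other members; in a direction separating
    it, the extreme point of [A] beats them all. *)
Lemma exposed_point F A : finite_set F -> (forall B, F B -> convex_body B) ->
  F A -> convex_hull (\bigcup_(B in F) B) <> convex_hull (\bigcup_(B in F `\ A) B) ->
  exists tp : R * plane R, [/\ 0 <= tp.1 < pi *+ 2, A tp.2,
    (forall x, A x -> dot (dir tp.1) x <= dot (dir tp.1) tp.2) &
    (forall B x, F B -> B <> A -> B x -> dot (dir tp.1) x < dot (dir tp.1) tp.2)].
Proof.
move=> Ffin Fbody FA neq; set K := convex_hull (\bigcup_(B in F `\ A) B) in neq.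
have [x Ax nKx] : exists2 x, A x & ~ K x.
  apply: contrapT => nx; apply: neq; apply/seteqP; split; last first.
    by apply: convex_hull_mono => x [B [FB _] Bx]; exists B.
  apply: convex_hull_min; first exact: convex_hull_convex.
  move=> x [B FB Bx]; have [BA|BA] := pselect (B = A).
    by rewrite BA in Bx; apply: contrapT => nKx; apply: nx; exists x.
  by apply: sub_convex_hull; exists B.
have kK : compact K.
  have /finite_seqP[s sE] : finite_set (F `\ A) by exact: finite_setD.
  rewrite /K sE; apply: convex_hull_finite_compact => B Bs.
  by have [/Fbody] : (F `\ A) B by rewrite sE.
have [t tK] := separation kK (@convex_hull_convex _ _) nKx.
have P0 : 0 < pi *+ 2 :> R by rewrite mulrn_wgt0// pi_gt0.
have [z] := shift_into_window t 0 P0; rewrite add0r => t0.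
have dirz : dir (t + (pi *+ 2) *~ z) = dir t.
  by apply: (periodicz (f := @dir R)) => ?; exact: dir_periodic.
have A0 : A !=set0 by exists x.
have [p Ap pmax] := dot_max (dir t) (Fbody _ FA).1 A0.
exists (t + (pi *+ 2) *~ z, p); split=> //=; rewrite dirz// => B y FB BA By.
apply: (@lt_le_trans _ _ (dot (dir t) x)); last exact: pmax.
by apply: tK; apply: sub_convex_hull; exists B.
Qed.

Lemma convex_position_ordering F : finite_set F ->
  (forall A, F A -> convex_body A) -> in_convex_position F ->
  exists2 s, ordering_of F s &
    forall i j k : nat, (i < j < k)%N -> (k < size s)%N ->
      ccw_oriented (nth set0 s i) (nth set0 s j) (nth set0 s k).
Proof.
move=> Ffin Fbody Fcvx.
have [f fP] : {f : set (plane R) -> R * plane R & forall A, F A ->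
   [/\ 0 <= (f A).1 < pi *+ 2, A (f A).2,
    (forall x, A x -> dot (dir (f A).1) x <= dot (dir (f A).1) (f A).2) &
    (forall B x, F B -> B <> A -> B x -> dot (dir (f A).1) x < dot (dir (f A).1) (f A).2)]}.
  apply: (@choice _ _ (fun A (tp : R * plane R) => F A ->
    [/\ 0 <= tp.1 < pi *+ 2, A tp.2,
      (forall x, A x -> dot (dir tp.1) x <= dot (dir tp.1) tp.2) &
      (forall B x, F B -> B <> A -> B x -> dot (dir tp.1) x < dot (dir tp.1) tp.2)])) => A.
  have [FA|nFA] := pselect (F A); last by exists (0, 0).
  by have [tp tpP] := exposed_point Ffin Fbody FA (Fcvx _ FA); exists tp.
pose leT A B := (f A).1 <= (f B).1.
have leT_tr : transitive leT by move=> A B C; exact: le_trans.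
have leT_rf : reflexive leT by move=> A; exact: lexx.
have leT_total : total leT by move=> A B; exact: le_total.
have /finite_seqP[s0 Fs0] := Ffin.
pose s := sort leT (undup s0).
have us : uniq s by rewrite sort_uniq undup_uniq.
have sF : [set` s] = F.
  by rewrite Fs0; apply/seteqP; split=> A /=; rewrite mem_sort mem_undup.
exists s => // i j k /andP[ij jk] ks.
have js : (j < size s)%N by exact: ltn_trans ks.
have is_ : (i < size s)%N by exact: ltn_trans js.
have Fn m : (m < size s)%N -> F (nth set0 s m).
  by move=> ms; rewrite -sF /=; exact: mem_nth.
have neq m n : (m < n)%N -> (n < size s)%N -> nth set0 s m <> nth set0 s n.
  move=> mn ns /eqP; rewrite nth_uniq// ?(ltn_trans mn ns)//.
  by move=> /eqP e; rewrite e ltnn in mn.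
have lt m n : (m < n)%N -> (n < size s)%N -> (f (nth set0 s m)).1 < (f (nth set0 s n)).1.
  move=> mn ns; have ms := ltn_trans mn ns.
  rewrite lt_neqAle; apply/andP; split; last first.
    have := sorted_leq_nth leT_tr leT_rf set0 (sort_sorted leT_total (undup s0)).
    by apply; rewrite ?inE// ltnW.
  (* Two members cannot both be strictly extreme in the same direction, so sorting is strict. *)
  apply/eqP => e.
  have [_ pm _ hm] := fP _ (Fn _ ms); have [_ pn _ hn] := fP _ (Fn _ ns).
  have := hm _ _ (Fn _ ns) (nesym (neq _ _ mn ns)) pn.
  have := hn _ _ (Fn _ ms) (neq _ _ mn ns) pm.
  by rewrite e => /lt_trans/[apply]; rewrite ltxx.
have lij := lt _ _ ij js; have ljk := lt _ _ jk ks.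
have nij := neq _ _ ij js; have njk := neq _ _ jk ks.
have nik := neq _ _ (ltn_trans ij jk) ks.
have [/andP[i0 i2] pi_ mi hi] := fP _ (Fn _ is_).
have [/andP[j0 j2] pj mj hj] := fP _ (Fn _ js).
have [/andP[k0 k2] pk mk hk] := fP _ (Fn _ ks).
move: (Fn _ is_) (Fn _ js) (Fn _ ks) lij ljk nij njk nik i0 i2 pi_ mi hi.
move: j0 j2 pj mj hj k0 k2 pk mk hk.
set A := nth set0 s i; set B := nth set0 s j; set C := nth set0 s k.
move=> j0 j2 pB mB hB k0 k2 pC mC hC FA FB FC lij ljk nij njk nik i0 i2 pA mA hA.
exists (f A).2, (f B).2, (f C).2.
have bnd X : F X -> (A `|` B `|` C) (f X).2 ->
    boundary (convex_hull (A `|` B `|` C)) (f X).2.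
  move=> FX ABCX; have [_ pX mX hX] := fP _ FX.
  apply: (@exposed_boundary _ _ (f X).1); first exact: sub_convex_hull.
  apply: convex_hull_min; first exact: convex_halfplane_le.
  have le Y y : F Y -> Y y -> dot (dir (f X).1) y <= dot (dir (f X).1) (f X).2.
    move=> FY Yy; have [YX|YX] := pselect (Y = X); first by rewrite YX in Yy; exact: mX.
    by apply: ltW; exact: hX FY YX Yy.
  by move=> y [[?|?]|?] /=; [apply: (le A)|apply: (le B)|apply: (le C)].
split.
- by split=> //; apply: bnd => //; left; left.
- by split=> //; apply: bnd => //; left; right.
- by split=> //; apply: bnd => //; right.
apply: (@exposed_ccw _ _ _ (f A).1 (f B).1 (f C).1) => //; first by lra.
- exact: hA FB (nesym nij) pB.
- exact: hA FC (nesym nik) pC.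
- exact: hB FA nij pA.
- exact: hB FC (nesym njk) pC.
- exact: hC FA nik pA.
- exact: hC FB njk pB.
Qed.

(** The members other than [A] amount to at most one convex body, so their union is its own hull. *)
Lemma small_convex_position F s : ordering_of F s -> (size s <= 2)%N ->
  (forall A, F A -> convex_body A) ->
  (forall A, F A -> ~ (A `<=` \bigcup_(B in F `\ A) B)) -> in_convex_position F.
Proof.
move=> [us sF] s2 Fbody Fsmall A FA e; apply: (Fsmall A FA) => x Ax.
have : convex_hull (\bigcup_(B in F `\ A) B) x.
  by rewrite -e; apply: sub_convex_hull; exists A.
suff cvx : convex_set (\bigcup_(B in F `\ A) B) by rewrite /convex_hull smallest_id.
have same B C : (F `\ A) B -> (F `\ A) C -> B = C.
  move=> [+ BA] [+ CA]; move: FA; rewrite -sF.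
  move: us s2 BA CA; case: s {sF} => [|X [|Y [|//]]] //= _ _ BA CA.
    by rewrite !mem_seq1 => _ /eqP -> /eqP ->.
  rewrite !mem_seq2 => /orP[] /eqP eA /orP[] /eqP eB /orP[] /eqP eC; congruence.
apply: convex_setI => y z l [B FB By] [C FC Cz] l01; exists B => //.
rewrite -(same _ _ FB FC) in Cz; apply: convex_comb => //.
by have [/Fbody[]] := FB.
Qed.

Lemma ordering_convex_position F s : (forall A, F A -> convex_body A) ->
  noncrossing F ->
  (forall A B, F A -> F B -> A <> B -> ~ tangent A B) ->
  (forall A B C, F A -> F B -> F C -> A <> B -> A <> C -> B <> C ->
     no_common_tangent A B C) ->
  ordering_of F s -> (2 < size s)%N ->
  (forall i j k : nat, (i < j < k)%N -> (k < size s)%N ->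
      ccw_oriented (nth set0 s i) (nth set0 s j) (nth set0 s k)) ->
  in_convex_position F.
Proof.
move=> Fbody Fnc Fnt Fnct [us sF] s2 Fccw.
set N := size s in s2 Fccw; pose b (i : nat) := nth set0 s i.
have Fb i : (i < N)%N -> F (b i) by move=> iN; rewrite -sF /=; exact: mem_nth.
have bneq i j : (i < N)%N -> (j < N)%N -> i <> j -> b i <> b j.
  by move=> iN jN ij /eqP; rewrite nth_uniq// => /eqP.
(* Every index occurs in a triple, [(0, 1, i)] or [(0, 1, 2)], whose witnesses are points of the
   members. *)
have b0 i : (i < N)%N -> b i !=set0.
  move=> iN; have [i2|i2] := leqP 2 i.
    by have [_ [_ [x [_ _ [Ax _] _]]]] := Fccw 0%N 1%N i i2 iN; exists x.
  have [x [y [_ [[Ax _] [Ay _] _ _]]]] := Fccw 0%N 1%N 2%N isT s2.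
  by case: i i2 {iN} => [|[|//]] _; [exists x | exists y].
have triple i j k : (i < j < k)%N -> (k < N)%N -> strict_triple (b i) (b j) (b k).
  move=> /andP[ij jk] kN; have jN := ltn_trans jk kN; have iN := ltn_trans ij jN.
  have nij : b i <> b j by apply: bneq => //; lia.
  have nik : b i <> b k by apply: bneq => //; lia.
  have njk : b j <> b k by apply: bneq => //; lia.
  apply: ccw_oriented_strict; try (by apply: Fbody; exact: Fb); try (by apply: Fnt => //; exact: Fb).
  - by apply: Fnt; rewrite //; [exact: Fb|exact: Fb|exact: nesym].
  - by apply: Fnct => //; exact: Fb.
  - by apply: Fccw => //; rewrite ij.
move=> A FA; have : A \in s by have : [set` s] A by rewrite sF.
move=> /(nthP set0)[n nN nA].
(* Indices up to [n] are pushed past [N], so that the order starts just after [n] and wraps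
   around. *)
pose key (j : 'I_N) := if (n < j)%N then (j : nat) else (j + N)%N.
have P0 : 0 < pi *+ 2 :> R by rewrite mulrn_wgt0// pi_gt0.
have bodyi (i : 'I_N) : convex_body (b i) by exact/Fbody/Fb.
have bi0 (i : 'I_N) : b i !=set0 by exact: b0.
have ordneq (i j : 'I_N) : i != j -> b i <> b j.
  by move=> ij; apply: bneq => // e; move/eqP: ij; apply; exact: val_inj.
have [t tP] : exists t, forall m : 'I_N, m != Ordinal nN ->
    supp (b m) t < supp (b (Ordinal nN)) t.
  apply: (@envelope_visible R (pi *+ 2) 'I_N (fun i => supp (b i)) (Ordinal nN) key) => //.
  - by move=> i t; exact: supp_periodic.
  - by move=> i; apply: supp_continuous => //; exact: (bodyi i).1.
  - move=> i j t1 t2 t3 t4 ij t12 t23 t34 t41.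
    apply: (@supp_no_alternation R (b i) (b j)) => //; first exact: (bodyi i).1.
    by have [] := Fnc _ _ (Fb i (ltn_ord i)) (Fb j (ltn_ord j)).
  - move=> i j t d ij e d0; apply: supp_cross => //; first exact: (bodyi j).1.
    by apply: Fnt; [exact: Fb|exact: Fb|exact: ordneq].
  - move=> i j k t ij ik jk.
    apply: (@no_common_tangent_supp R (b i) (b j) (b k) t) => //; try exact: (bodyi _).1.
    by apply: Fnct; by [exact: Fb|exact: ordneq].
  - move=> j k jn kn jk; rewrite /key; move: jn kn jk; rewrite -!val_eqE /=.
    by case: ifP; case: ifP; have := ltn_ord j; have := ltn_ord k; lia.
  - move=> j k; rewrite -!val_eqE /key /= => jn kn.
    have jN := ltn_ord j; have kN := ltn_ord k.
    (* The increasing triple is [(n, j, k)], [(k, n, j)] or [(j, k, n)], each a rotation of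
       [(j, k, n)]; the remaining case contradicts the order of the keys. *)
    case: ifP => nj; case: ifP => nk jk.
    + by apply: strict_triple_rot; apply: triple => //; lia.
    + by apply: strict_triple_rot; apply: strict_triple_rot; apply: triple => //; lia.
    + by lia.
    + by apply: triple => //; lia.
  - by rewrite card_ord.
rewrite -nA; apply: (@visible_hull_neq F (b n) t); first exact: Fb.
- exact: (bodyi (Ordinal nN)).1.
- exact: b0.
move=> B x FB; have : B \in s by have : [set` s] B by rewrite sF.
move=> /(nthP set0)[m mN <-] nmn Bx.
have mn : Ordinal mN != Ordinal nN by apply/eqP => -[e]; apply: nmn; rewrite e.
apply: le_lt_trans (tP _ mn); apply: le_supp => //.
exact: (bodyi (Ordinal mN)).1.
Qed.

End ConvexPosition.

Theorem theorem3 (R : realType) (F : set (set (plane R)))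
  (Ffin : finite_set F)
  (Fbody : forall A, F A -> convex_body A)
  (Fnoncrossing : noncrossing F)
  (Fnot_tangent : forall A B, F A -> F B -> A <> B -> ~ tangent A B)
  (Fno_common_tangent : forall A B C, F A -> F B -> F C ->
     A <> B -> A <> C -> B <> C ->
     ~ exists l, [/\ tangent_line l A, tangent_line l B & tangent_line l C])
  (* With at most two members there are no triples, and the equivalence fails
     exactly when a member is contained in the union of the others. *)
  (Fsmall : (F #<= `I_2)%card ->
     forall A, F A -> ~ (A `<=` \bigcup_(B in F `\ A) B)) :
  in_convex_position F <->
  exists2 s : seq (set (plane R)), ordering_of F s &
    forall i j k : nat, (i < j < k)%N -> (k < size s)%N ->
      ccw_oriented (nth set0 s i) (nth set0 s j) (nth set0 s k).
Proof.
split=> [|[s sF Fccw]]; first exact: convex_position_ordering.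
have [s2|s2] := leqP (size s) 2; last exact: ordering_convex_position sF s2 Fccw.
apply: (small_convex_position sF s2 Fbody); apply: Fsmall.
have [_ <-] := sF.
(* Indexing by positions bounds the cardinality of the family by the length of [s]. *)
have -> : [set` s] = [set nth set0 s i | i in `I_(size s)].
  apply/seteqP; split=> A /=.
    by move=> /(nthP set0)[i iN <-]; exists i.
  by move=> [i iN <-]; exact: mem_nth.
by apply: card_le_trans (card_image_le _ _) _; rewrite card_le_II.
Qed.
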